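(* Let $0<\vartheta<\pi/2$ and $a>0$. If $I(\vartheta,a)$ is a reptile and $\vartheta/\pi\in\mathbb{Q}$, then $\vartheta=\pi/3$.
   Context: $I(\vartheta,a)$ denotes the isosceles trapezoid (not a parallelogram) whose two legs have length $1$, whose acute internal angles equal $\vartheta$, and whose shorter base has length $a$ (so the longer base has length $a+2\cos\vartheta$). A planar figure is rep-$n$ if it can be dissected into $n$ similar copies of itself that are congruent to each other (reflected copies are allowed); it is a reptile if it is rep-$n$ for some $n\ge 2$. *)

(* Defs.v *)
From HB Require Import structures.
From mathcomp Require Import all_boot all_order all_algebra.
From mathcomp Require Import all_classical all_reals all_analysis.

Set Implicit Arguments.
Unset Strict Implicit.
Unset Printing Implicit Defensive.

Import Order.TTheory GRing.Theory Num.Theory.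
Import numFieldNormedType.Exports.

Local Open Scope classical_set_scope.
Local Open Scope ring_scope.

(* [R^o] rather than [R], so that the plane is an [lmodType R]. *)
Notation plane R := (R^o * R^o)%type.

(* The library's norm on a product is the max norm, hence the explicit
   Euclidean distance; the topologies, and so the interiors, are the same. *)
Definition edist (R : realType) (p q : plane R) : R :=
  Num.sqrt ((p.1 - q.1) ^+ 2 + (p.2 - q.2) ^+ 2).

(* Orientation-reversing maps are included. *)
Definition similarity (R : realType) (k : R) (f : plane R -> plane R) : Prop :=
  forall p q, edist (f p) (f q) = k * edist p q.

Definition similar (R : realType) (A B : set (plane R)) : Prop :=
  exists (k : R) (f : plane R -> plane R),
    [/\ 0 < k, similarity k f & B = f @` A].

Definition congruent (R : realType) (A B : set (plane R)) : Prop :=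
  exists2 f : plane R -> plane R, similarity 1 f & B = f @` A.

Definition dissection (R : realType) (n : nat) (A : set (plane R))
    (T : 'I_n -> set (plane R)) : Prop :=
  \bigcup_i T i = A /\ forall i j, i != j -> (T i)° `&` (T j)° = set0.

Definition rep_n (R : realType) (n : nat) (A : set (plane R)) : Prop :=
  exists T : 'I_n -> set (plane R),
    [/\ dissection A T,
        forall i, similar A (T i) &
        forall i j, congruent (T i) (T j)].

Definition reptile (R : realType) (A : set (plane R)) : Prop :=
  exists2 n, (2 <= n)%N & rep_n n A.

Definition convex_hull (R : realType) (A : set (plane R)) :
    set (plane R) :=
  smallest (@convex_set R (plane R)) A.

(* I(theta, a), placed with its longer base on the x-axis and the left end of
   that base at the origin. *)
Definition isosceles_trapezoid (R : realType) (theta a : R) :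
    set (plane R) :=
  convex_hull [set (0, 0); (a + 2 * cos theta, 0);
                   (cos theta + a, sin theta); (cos theta, sin theta)].

(* Main.v *)
Require Import Defs.
From mathcomp Require Import all_boot all_order all_algebra.
From mathcomp Require Import ring lra.
From mathcomp Require Import all_classical all_reals all_analysis.

Set Implicit Arguments.
Unset Strict Implicit.
Unset Printing Implicit Defensive.

Import Order.TTheory GRing.Theory Num.Theory.
Import numFieldNormedType.Exports.
Local Open Scope classical_set_scope.
Local Open Scope ring_scope.

(** Write c for the cosine and s for the sine of the acute angle, and b = a + 2c
   for the long base. Taking a piece of the rep-tiling as unit, a trapezoid with
   legs lam and bases lam a and lam b is tiled by n congruent trapezoids with legs 1
   and bases a and b, and comparing areas gives lam^2 = n ([scale_square]; the area
   is replaced by a count of the pieces of the iterated rep-tiling). The whole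
   point is that c must be rational ([cos_rational]): a rational multiple of pi
   with a rational cosine between 0 and 1 is pi/3 ([rational_cos_rational_angle]).

   Locally, a ray that enters no piece is a side of the piece lying to its right
   ([edge_through]), and a free angle equal to the acute one is filled by a single
   acute corner ([wedge]). Hence each side of the large trapezoid is a
   concatenation of sides of pieces, so that lam, lam a and lam b are combinations
   of 1, a and b with natural coefficients. The angles at the vertices give more:
   the leg carries a leg or a long base, so does the short base, and the long base
   carries a long base.

   If lam is irrational, the integer matrix of these three equations has the
   eigenvalue -lam together with lam. An eigenvector for -lam, compared with the
   positive eigenvector (1, a, b) for lam in the manner of Perron, contradicts the
   extra information ([no_irrational_scale]).

   If lam is rational and c is not, the irrational parts in the equation of
   the short base show that no segment of rational length carries a long base
   ([rational_no_long]). Therefore the left leg carries lam legs of upright pieces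
   stacked on each other ([up_tile]); the free angle at the upper right corner of
   each of them is filled by a piece turned upside down ([down_tile]). Together
   they form a column, a parallelogram of width a + b along the left leg, and the
   rest is again a trapezoid with leg lam to which the argument applies. Column
   follows column, which the finite width forbids ([no_columns]). *)

(** * Vectors and small parameters *)

Section PlaneVectors.
Variable R : realType.
Implicit Types (d p v : plane R).

(** Multiplication by d, and by its conjugate, of complex numbers. *)
Definition rot d v : plane R := (d.1 * v.1 - d.2 * v.2, d.1 * v.2 + d.2 * v.1).
Definition unrot d v : plane R := (d.1 * v.1 + d.2 * v.2, d.1 * v.2 - d.2 * v.1).
Definition unit_vec d := d.1 * d.1 + d.2 * d.2 = 1.
Definition right_of d : plane R := (d.2, - d.1).

Lemma plane_eq p v : p.1 = v.1 -> p.2 = v.2 -> p = v.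
Proof. by case: p; case: v => ? ? ? ? /= -> ->. Qed.

End PlaneVectors.

Section Soon.
Variable R : realType.
Implicit Types P Q : R -> Prop.

Definition soon P := exists2 e0 : R, 0 < e0 & forall e, 0 < e <= e0 -> P e.

Lemma soon_and P Q : soon P -> soon Q -> soon (fun e => P e /\ Q e).
Proof.
move=> [e1 e10 H1] [e2 e20 H2]; exists (Num.min e1 e2); first by rewrite lt_min e10.
by move=> e /andP[e0]; rewrite le_min => /andP[? ?]; split; [apply: H1|apply: H2]; rewrite e0.
Qed.

Lemma soon_imp P Q : (forall e, 0 < e -> P e -> Q e) -> soon P -> soon Q.
Proof. by move=> H [e0 ? He]; exists e0 => // e /andP[? ?]; apply: H => //; apply: He; apply/andP. Qed.

Lemma soon_ex P : soon P -> exists2 e, 0 < e & P e.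
Proof. by move=> [e e0 H]; exists e => //; apply: H; rewrite e0 lexx. Qed.

Lemma soon_lt x : 0 < x -> soon (fun e => e < x).
Proof. by move=> x0; exists (x / 2) => [|e]; lra. Qed.

Lemma soon_all P : (forall e, 0 < e -> P e) -> soon P.
Proof. by move=> H; exists 1 => // e /andP[? _]; exact: H. Qed.

Lemma soon_gt0 x y : 0 < x \/ x = 0 /\ 0 < y -> soon (fun e => 0 < x + e * y).
Proof.
move=> H; have [x0|x0] := ltP 0 x.
  have N0 : 0 < 2 * (`|y| + 1) by rewrite mulr_gt0// ltr_wpDl.
  exists (x / (2 * (`|y| + 1))); first by rewrite divr_gt0.
  move=> e /andP[e0]; rewrite ler_pdivlMr// => He.
  have := ler_norm (- y); rewrite normrN.
  by move: (`|y|) (normr_ge0 y) He => v; nra.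
case: H => [|[-> y0]]; first by rewrite ltNge x0.
by apply: soon_all => e e0; rewrite add0r mulr_gt0.
Qed.

End Soon.

Section LexSign.
Variable R : realType.

(** The sign of x + eps (y + del z) when del is small, and eps is small with
   respect to del. *)
Definition lexpos (t : R * R * R) : Prop :=
  [\/ 0 < t.1.1, t.1.1 = 0 /\ 0 < t.1.2 | [/\ t.1.1 = 0, t.1.2 = 0 & 0 < t.2]].

Lemma lexposN t : t.1.2 != 0 \/ t.2 != 0 -> ~ lexpos t ->
  lexpos (- t.1.1, - t.1.2, - t.2).
Proof.
case: t => -[x y] z /= yz nl; rewrite /lexpos /=.
have [x0|x0|x0] := ltgtP x 0.
- by constructor 1; rewrite oppr_gt0.
- by case: nl; constructor 1.
have [y0|y0|y0] := ltgtP y 0.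
- by constructor 2; rewrite x0 oppr0 oppr_gt0.
- by case: nl; constructor 2.
have [z0|z0|z0] := ltgtP z 0.
- by constructor 3; rewrite x0 y0 oppr0 oppr_gt0.
- by case: nl; constructor 3.
by case: yz; rewrite ?y0 ?z0 eqxx.
Qed.

Lemma lexpos_soon t : lexpos t ->
  soon (fun del => soon (fun eps => 0 < t.1.1 + eps * (t.1.2 + del * t.2))).
Proof.
case: t => -[x y] z [/= x0|[/= -> y0]|[/= -> -> z0]].
- by apply: soon_all => del _; apply: soon_gt0; left.
- apply: (soon_imp _ (@soon_gt0 _ y z _)); last by left.
  by move=> del _ yz; apply: soon_gt0; right.
- apply: soon_all => del del0; apply: soon_gt0; right; split => //.
  by rewrite add0r mulr_gt0.
Qed.

(** One pair of scales realizes finitely many lexicographic signs at once, which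
   turns statements about directions at a point into statements about a nearby
   point. *)
Lemma lexpos_realize (ts : seq (R * R * R)) : exists del eps : R,
  [/\ 0 < del, 0 < eps &
   forall t, t \in ts -> lexpos t -> 0 < t.1.1 + eps * (t.1.2 + del * t.2)].
Proof.
suff : soon (fun del => soon (fun eps => forall t, t \in ts -> lexpos t ->
    0 < t.1.1 + eps * (t.1.2 + del * t.2))).
  by move=> /soon_ex[del del0] /soon_ex[eps eps0 H]; exists del, eps.
elim: ts => [|t ts IH]; first by do 2![apply: soon_all => ? _].
have Ht : soon (fun del => soon (fun eps => lexpos t -> 0 < t.1.1 + eps * (t.1.2 + del * t.2))).
  have [lt_|nlt] := pselect (lexpos t); last by do 2![apply: soon_all => ? _].
  apply: soon_imp (lexpos_soon lt_) => del _; exact: soon_imp.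
apply: soon_imp (soon_and Ht IH) => del _ [H1 H2].
apply: soon_imp (soon_and H1 H2) => eps _ [K1 K2] u.
by rewrite inE => /orP[/eqP ->|/K2].
Qed.

End LexSign.

(** * The trapezoid and its sides *)

(** A side stands both for an edge, traversed clockwise, so that the trapezoid lies
   to its right, and for the half-plane bounded by its line. *)
Inductive side := Long | LegL | Short | LegR.

Section Trapezoid.
Variables (R : realType) (c s a : R).
Hypotheses (c_gt0 : 0 < c) (s_gt0 : 0 < s) (a_gt0 : 0 < a).
Hypothesis cs1 : c * c + s * s = 1.
Implicit Types (o d p q r : plane R) (l : R).

Definition base := a + 2 * c.
Local Notation b := base.

Lemma b_gt0 : 0 < b. Proof. by rewrite /base addr_gt0// mulr_gt0. Qed.

(** The distance of q to the line of a side, counted positively inside, for legs of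
   length l. The origin is the left acute corner, the first axis runs along the
   long base. The linear part of this affine function is [slope]. *)
Definition gap l (e : side) q : R :=
  match e with
  | Long => q.2
  | LegL => s * q.1 - c * q.2
  | Short => l * s - q.2
  | LegR => s * (l * b - q.1) - c * q.2
  end.

Definition slope (e : side) q : R :=
  match e with
  | Long => q.2
  | LegL => s * q.1 - c * q.2
  | Short => - q.2
  | LegR => - s * q.1 - c * q.2
  end.

(** The copy with legs l has its left acute corner at o, and the unit vector d points
   along its long base. *)
Definition gap_at l o d e p := gap l e (unrot d (p - o)).
Definition tile l o d p := forall e, 0 <= gap_at l o d e p.
Definition tile_in l o d p := forall e, 0 < gap_at l o d e p.

Definition len (e : side) : R :=
  match e with Long => b | LegL => 1 | Short => a | LegR => 1 end.
Definition ldir (e : side) : plane R :=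
  match e with
  | Long => (-1, 0) | LegL => (c, s) | Short => (1, 0) | LegR => (c, - s)
  end.
Definition lcorner (e : side) : plane R :=
  match e with
  | Long => (b, 0) | LegL => (0, 0) | Short => (c, s) | LegR => (c + a, s)
  end.
Definition dir d (e : side) : plane R := rot d (ldir e).
Definition corner o d (e : side) : plane R := o + rot d (lcorner e).

Lemma len_gt0 e : 0 < len e.
Proof. by case: e => //=; exact: b_gt0. Qed.

Lemma tile_inW l o d p : tile_in l o d p -> tile l o d p.
Proof. by move=> H e; apply: ltW. Qed.

Lemma gap_atD l o d e p t v :
  gap_at l o d e (p + t *: v) = gap_at l o d e p + t * slope e (unrot d v).
Proof. by case: e; rewrite /gap_at /gap /slope /unrot /= /GRing.scale /=; ring. Qed.

Lemma slope_right d e r :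
  slope e (unrot d (right_of r)) = slope e (right_of (unrot d r)).
Proof. by case: e; rewrite /slope /unrot /right_of /=; ring. Qed.

Lemma slope_lin e r v t : slope e (r + t *: v) = slope e r + t * slope e v.
Proof. by case: e; rewrite /slope /= /GRing.scale /=; ring. Qed.

Lemma unrotD d v r t : unrot d (v + t *: r) = unrot d v + t *: unrot d r.
Proof. by apply: plane_eq; rewrite /unrot /= /GRing.scale /=; ring. Qed.

(** The directions at p leaving to the right of r, infinitesimally close to r,
   point into the tile. *)
Definition germ l o d p r := forall e,
  lexpos (gap_at l o d e p, slope e (unrot d r), slope e (unrot d (right_of r))).

(** A line is not parallel to two perpendicular directions, so the lexicographic
   signs that define germs are never zero. *)
Lemma slope_neq0 e q : q.1 * q.1 + q.2 * q.2 = 1 ->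
  slope e q != 0 \/ slope e (right_of q) != 0.
Proof.
move=> q1.
have [s1|] := eqVneq (slope e q) 0; last by left.
have [s2|] := eqVneq (slope e (right_of q)) 0; last by right.
exfalso.
have : slope e q * slope e q + slope e (right_of q) * slope e (right_of q) =
  q.1 * q.1 + q.2 * q.2.
  case: (e); rewrite /slope /right_of /=; [ring| |ring|];
    rewrite -[RHS]mul1r -cs1; ring.
by rewrite s1 s2 q1 mulr0 addr0 => /eqP; rewrite eq_sym oner_eq0.
Qed.

Lemma unit_unrot d r : unit_vec d -> unit_vec r -> unit_vec (unrot d r).
Proof.
rewrite /unit_vec /unrot /= => d1 r1.
transitivity ((d.1 * d.1 + d.2 * d.2) * (r.1 * r.1 + r.2 * r.2)); first ring.
by rewrite d1 r1 mulr1.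
Qed.

Lemma rotK d v : unit_vec d -> rot d (unrot d v) = v.
Proof.
rewrite /unit_vec /rot /unrot => d1; apply: plane_eq => /=.
  transitivity ((d.1 * d.1 + d.2 * d.2) * v.1); first ring.
  by rewrite d1 mul1r.
transitivity ((d.1 * d.1 + d.2 * d.2) * v.2); first ring.
by rewrite d1 mul1r.
Qed.

Lemma unrotK d v : unit_vec d -> unrot d (rot d v) = v.
Proof.
rewrite /unit_vec /rot /unrot => d1; apply: plane_eq => /=.
  transitivity ((d.1 * d.1 + d.2 * d.2) * v.1); first ring.
  by rewrite d1 mul1r.
transitivity ((d.1 * d.1 + d.2 * d.2) * v.2); first ring.
by rewrite d1 mul1r.
Qed.

Ltac lexd H := case: H => /= [H|[H ?]|[H ? ?]].

(** If the directions to the right of u point inside while u itself does not, the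
   side that stops u has q on its line and, being traversed clockwise, runs in the
   direction u; the other half-planes then place q on that side, the end point
   excluded. *)
Lemma local_edge q (u : plane R) : u.1 * u.1 + u.2 * u.2 = 1 ->
  (forall e, lexpos (gap 1 e q, slope e u, slope e (right_of u))) ->
  forall e0, gap 1 e0 q <= 0 -> slope e0 u <= 0 ->
  exists e t, [/\ u = ldir e, q = lcorner e + t *: ldir e & 0 <= t < len e].
Proof.
case: q u => x y [u v] /= uv H.
have H1 := H Long; have H2 := H LegL; have H3 := H Short; have H4 := H LegR.
move=> e0 g0 s0; exists e0; move: g0 s0.
rewrite /gap /slope /lexpos /base /right_of /= in H1 H2 H3 H4 *.
have s0 := s_gt0; have c0 := c_gt0; have a0 := a_gt0; have cs := cs1.
case: e0 => /= gg ss.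
- have [y0 v0 u0] : [/\ y = 0, v = 0 & u < 0] by case: H1 => [?|[? ?]|[? ? ?]]; split; lra.
  have u1 : u = -1 by subst v; nra.
  subst y v u; exists (a + 2 * c - x); split => //.
    by apply: plane_eq => /=; rewrite /base /GRing.scale /=; ring.
  by rewrite /= /base; apply/andP; split; [lexd H4|lexd H2]; nra.
- have [y0 v0 u0] : [/\ s * x = c * y, s * u = c * v & 0 < s * v + c * u].
    by case: H2 => [?|[? ?]|[? ? ?]]; split; lra.
  have w1 : s * v + c * u = 1.
    have : (s * v + c * u) * (s * v + c * u) = 1.
      transitivity ((s * v + c * u) * (s * v + c * u) + (s * u - c * v) * (s * u - c * v)).
        by rewrite v0 subrr mulr0 addr0.
      transitivity ((c * c + s * s) * (u * u + v * v)); first ring.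
      by rewrite cs uv mulr1.
    by move: (s * v + c * u) u0 => w; nra.
  have u1 : u = c.
    transitivity ((c * c + s * s) * u); first by rewrite cs mul1r.
    transitivity (c * (s * v + c * u)); last by rewrite w1 mulr1.
    by have := congr1 (fun z => s * z) v0; lra.
  have v1 : v = s.
    transitivity ((c * c + s * s) * v); first by rewrite cs mul1r.
    transitivity (s * (s * v + c * u)); last by rewrite w1 mulr1.
    by have := congr1 (fun z => c * z) v0; lra.
  subst u v; exists (y / s); split => //.
    apply: plane_eq => /=; rewrite /base /GRing.scale /= add0r; last by rewrite divfK// gt_eqF.
    apply: (mulfI (lt0r_neq0 s_gt0)); rewrite y0 mulrA [s * _]mulrC divfK ?gt_eqF//; ring.
  have y0' : 0 <= y by lexd H1; lra.
  have ys : y < s by lexd H3; lra.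
  by rewrite divr_ge0 ?(ltW s_gt0)//= ltr_pdivrMr// mul1r.
- have [y0 v0 u0] : [/\ y = s, v = 0 & 0 < u] by case: H3 => [?|[? ?]|[? ? ?]]; split; lra.
  have u1 : u = 1 by subst v; nra.
  subst y v u; exists (x - c); split => //.
    by apply: plane_eq => /=; rewrite /base /GRing.scale /=; ring.
  by rewrite /= /base; apply/andP; split; [lexd H2|lexd H4]; nra.
- have [y0 v0 u0] : [/\ s * (a + 2 * c - x) = c * y, s * u = - (c * v) & 0 < c * u - s * v].
    by case: H4 => [?|[? ?]|[? ? ?]]; split; lra.
  have w1 : c * u - s * v = 1.
    have : (c * u - s * v) * (c * u - s * v) = 1.
      transitivity ((c * u - s * v) * (c * u - s * v) + (s * u + c * v) * (s * u + c * v)).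
        by rewrite v0 addNr mulr0 addr0.
      transitivity ((c * c + s * s) * (u * u + v * v)); first ring.
      by rewrite cs uv mulr1.
    by move: (c * u - s * v) u0 => w; nra.
  have u1 : u = c.
    transitivity ((c * c + s * s) * u); first by rewrite cs mul1r.
    transitivity (c * (c * u - s * v)); last by rewrite w1 mulr1.
    by have := congr1 (fun z => s * z) v0; lra.
  have v1 : v = - s.
    transitivity ((c * c + s * s) * v); first by rewrite cs mul1r.
    transitivity (- s * (c * u - s * v)); last by rewrite w1 mulr1.
    by have := congr1 (fun z => c * z) v0; lra.
  subst u v; exists (1 - y / s); split => //.
    apply: plane_eq => /=; rewrite /base /GRing.scale /=; last first.
      by rewrite mulrBl mul1r mulrN divfK ?gt_eqF//; ring.
    apply: (mulfI (lt0r_neq0 s_gt0)).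
    have /(congr1 (fun z => c * z)) : y = y / s * s by rewrite divfK// gt_eqF.
    by move: (y / s) => w ?; lra.
  have y0' : 0 < y by lexd H1; lra.
  have ys : y <= s by lexd H3; lra.
  have : 0 < y / s by rewrite divr_gt0.
  have : y / s <= 1 by rewrite ler_pdivrMr// mul1r.
  by move=> /= ? ?; apply/andP; split; lra.
Qed.

Lemma local_germ e t : 0 <= t < len e ->
  forall e', lexpos (gap 1 e' (lcorner e + t *: ldir e), slope e' (ldir e),
                     slope e' (right_of (ldir e))).
Proof.
have s0 := s_gt0; have c0 := c_gt0; have a0 := a_gt0; have cs := cs1.
have sc0 : 0 < s * c by rewrite mulr_gt0.
have sa0 : 0 < s * a by rewrite mulr_gt0.
move=> /andP[]; rewrite le_eqVlt => /orP[/eqP <-|t0] t1 e'; rewrite /lexpos;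
  move: t1; case: e; case: e'; rewrite /gap /slope /right_of /= /base /GRing.scale /= => t1;
  try (by constructor 1; nra);
  try (by constructor 2; split; nra);
  try (by constructor 3; split; nra).
Qed.

End Trapezoid.

(** * Rational numbers and the equations of the sides *)

Section Rationals.
Variable R : realType.
Implicit Types x y : R.

Definition is_rat x := exists q : rat, x = ratr q.

Lemma is_ratD x y : is_rat x -> is_rat y -> is_rat (x + y).
Proof. by move=> [p ->] [q ->]; exists (p + q); rewrite rmorphD. Qed.

Lemma is_ratN x : is_rat x -> is_rat (- x).
Proof. by move=> [p ->]; exists (- p); rewrite rmorphN. Qed.

Lemma is_ratM x y : is_rat x -> is_rat y -> is_rat (x * y).
Proof. by move=> [p ->] [q ->]; exists (p * q); rewrite rmorphM. Qed.

Lemma is_ratV x : is_rat x -> is_rat x^-1.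
Proof. by move=> [p ->]; exists p^-1; rewrite fmorphV. Qed.

Lemma is_rat_int (z : int) : is_rat z%:~R.
Proof. by exists z%:~R; rewrite ratr_int. Qed.

Lemma is_rat_nat (k : nat) : is_rat k%:R.
Proof. by exists k%:R; rewrite ratr_nat. Qed.

End Rationals.

Section Spectrum.
Variables (R : realType) (lam : R) (n : nat).
Hypotheses (lam2 : lam ^+ 2 = n%:R) (lam_irrat : ~ is_rat lam).

(** An integer cubic that vanishes at an irrational square root vanishes at its
   opposite too. *)
Lemma cubic_conj (z0 z1 z2 z3 : int) :
  z0%:~R + z1%:~R * lam + z2%:~R * lam ^+ 2 + z3%:~R * lam ^+ 3 = 0 ->
  z0%:~R - z1%:~R * lam + z2%:~R * lam ^+ 2 - z3%:~R * lam ^+ 3 = 0.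
Proof.
have l3 : lam ^+ 3 = n%:R * lam by rewrite exprS lam2 mulrC.
rewrite l3 lam2 => E.
have [k0|k0] := eqVneq ((z1%:~R + z3%:~R * n%:R) : R) 0.
  have z10 : z1%:~R * lam + z3%:~R * (n%:R * lam) = 0 by rewrite mulrA -mulrDl k0 mul0r.
  lra.
case: lam_irrat.
have -> : lam = - (z0%:~R + z2%:~R * n%:R) / (z1%:~R + z3%:~R * n%:R).
  apply: (mulIf k0); rewrite divfK//; lra.
by apply: is_ratM; [apply: is_ratN|apply: is_ratV]; apply: is_ratD; rewrite ?mulr1;
  first [exact: is_rat_int|apply: is_ratM; [exact: is_rat_int|exact: is_rat_nat]].
Qed.

(** The characteristic polynomial of N is such a cubic. *)
Lemma conj_eigenvector (N : 'M[int]_3) (v : 'rV[R]_3) : v != 0 ->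
  v *m map_mx intr N = lam *: v ->
  exists2 u : 'rV[R]_3, u != 0 & u *m map_mx intr N = - lam *: u.
Proof.
move=> v0 vE.
have : root (char_poly (map_mx intr N : 'M[R]_3)) lam.
  by rewrite -eigenvalue_root_char; apply/eigenvalueP; exists v.
have szp : size (char_poly N) = 4%N by rewrite size_char_poly.
rewrite -map_char_poly /root horner_coef size_map_poly_id0; last first.
  by rewrite (monicP (char_poly_monic N)) intr_eq0.
rewrite szp !big_ord_recl big_ord0 /= !coef_map /= expr0 expr1 !mulr1 addr0 => /eqP E.
have : root (char_poly (map_mx intr N : 'M[R]_3)) (- lam).
  rewrite -map_char_poly /root horner_coef size_map_poly_id0; last first.
    by rewrite (monicP (char_poly_monic N)) intr_eq0.
  rewrite szp !big_ord_recl big_ord0 /= !coef_map /= expr0 expr1 !mulr1 addr0.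
  apply/eqP; rewrite /bump /=.
  have := cubic_conj (z0 := (char_poly N)`_0) (z1 := (char_poly N)`_1)
    (z2 := (char_poly N)`_2) (z3 := (char_poly N)`_3).
  rewrite /bump /= in E; move=> /(_ _)/wrap[]; first by rewrite -!addrA.
  by move=> <-; rewrite sqrrN exprNn; ring.
by rewrite -eigenvalue_root_char => /eigenvalueP[u uE u0]; exists u.
Qed.

Lemma sum0_terms (N1 N2 N3 : nat) (p q r : R) : 0 <= p -> 0 <= q -> 0 <= r ->
  N1%:R * p + N2%:R * q + N3%:R * r = 0 ->
  [/\ (0 < N1)%N -> p = 0, (0 < N2)%N -> q = 0 & (0 < N3)%N -> r = 0].
Proof.
move=> p0 q0 r0 E.
have [H1 H2 H3] : [/\ N1%:R * p = 0, N2%:R * q = 0 & N3%:R * r = 0].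
  have := mulr_ge0 (ler0n R N1) p0; have := mulr_ge0 (ler0n R N2) q0.
  have := mulr_ge0 (ler0n R N3) r0; split; lra.
by split; rewrite lt0n => N0; [move/eqP: H1|move/eqP: H2|move/eqP: H3];
  rewrite mulf_eq0 pnatr_eq0 (negbTE N0) => /eqP.
Qed.

Lemma tight_row (M a b u1 u2 u3 e w : R) (N1 N2 N3 : nat) :
  `|u1| <= M -> `|u2| <= M * a -> `|u3| <= M * b ->
  lam * w = N1%:R + N2%:R * a + N3%:R * b ->
  u1 * N1%:R + u2 * N2%:R + u3 * N3%:R = - lam * e -> e = M * w ->
  [/\ (0 < N1)%N -> u1 = - M, (0 < N2)%N -> u2 = - (M * a) & (0 < N3)%N -> u3 = - (M * b)].
Proof.
rewrite !ler_norml => /andP[? _] /andP[? _] /andP[? _] Hw He eE.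
have [||||H1 H2 H3] := @sum0_terms N1 N2 N3 (M + u1) (M * a + u2) (M * b + u3); try lra.
  by have := congr1 (fun z => M * z) Hw; rewrite eE in He; rewrite /=; lra.
by split => [/H1|/H2|/H3]; lra.
Qed.

(** Perron: compare u with the positive eigenvector v = (1, a, b). Where the
   ratio of |u_j| to v_j is maximal, the equation of index j is tight, so that it
   involves only entries of u with the opposite sign and the same ratio. This
   excludes b, whose equation involves b itself, then 1, whose equation involves
   1 or b, and then a, whose equation cannot involve only a. *)
Lemma no_extremal_entry (M a b u1 u2 u3 : R) (x1 y1 z1 x2 y2 z2 x3 y3 z3 : nat) :
  0 < lam -> 0 < a -> 0 < b -> 0 < M -> (0 < x1 + z1)%N ->
  lam = x1%:R + y1%:R * a + z1%:R * b ->
  lam * a = x2%:R + y2%:R * a + z2%:R * b ->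
  lam * b = x3%:R + y3%:R * a + z3.+1%:R * b ->
  u1 * x1%:R + u2 * y1%:R + u3 * z1%:R = - lam * u1 ->
  u1 * x2%:R + u2 * y2%:R + u3 * z2%:R = - lam * u2 ->
  u1 * x3%:R + u2 * y3%:R + u3 * z3.+1%:R = - lam * u3 ->
  `|u1| <= M -> `|u2| <= M * a -> `|u3| <= M * b ->
  [/\ u1 <> M, u2 <> M * a & u3 <> M * b].
Proof.
move=> l0 a0 b0 M0 xz E1 E2 E3; move: u1 u2 u3.
have step (w1 w2 w3 : R) :
  w1 * x1%:R + w2 * y1%:R + w3 * z1%:R = - lam * w1 ->
  w1 * x3%:R + w2 * y3%:R + w3 * z3.+1%:R = - lam * w3 ->
  `|w1| <= M -> `|w2| <= M * a -> `|w3| <= M * b -> w3 <> M * b /\ (w3 <> - (M * b) -> w1 <> M).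
  move=> F1 F3 M1 M2 M3; have Mb := mulr_gt0 M0 b0.
  have {F1}T1 := tight_row M1 M2 M3 (etrans (mulr1 _) E1) F1.
  have {F3}T3 := tight_row M1 M2 M3 E3 F3.
  move: E1 E2 E3 => _ _ _; split => [E|n3 E].
    by have [_ _ /(_ isT)] := T3 E; lra.
  have [|H1 _ H3] := T1; first by rewrite mulr1.
  move: xz; rewrite addn_gt0 => /orP[/H1|/H3 //]; lra.
have neg (w1 w2 w3 w : R) (N1 N2 N3 : nat) :
    w1 * N1%:R + w2 * N2%:R + w3 * N3%:R = - lam * w ->
    - w1 * N1%:R + - w2 * N2%:R + - w3 * N3%:R = - lam * - w.
  by rewrite mulrN => <-; ring.
move=> u1 u2 u3 F1 F2 F3 M1 M2 M3.
have [n3 n1] := step _ _ _ F1 F3 M1 M2 M3.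
have [|||||n3' n1'] := step (- u1) (- u2) (- u3) _ _ _ _ _; rewrite ?normrN //; try exact: neg.
have {}n1 : u1 <> M by apply: n1 => E; apply: n3'; rewrite E opprK.
have {}n1' : u1 <> - M by move=> E; apply: n1'; rewrite ?E ?opprK// => /oppr_inj.
split => // E; have [H1 H2 H3] := tight_row M1 M2 M3 E2 F2 E.
have x0 : x2 = 0%N by apply/eqP; rewrite eqn0Ngt; apply/negP => /H1.
have z0 : z2 = 0%N by apply/eqP; rewrite eqn0Ngt; apply/negP => /H3 E'; apply: n3'; rewrite E' opprK.
have y0 : y2 = 0%N.
  apply/eqP; rewrite eqn0Ngt; apply/negP => /H2; have := mulr_gt0 M0 a0.
  by move: E1 E2 E3 F1 F2 F3 => _ _ _ _ _ _; lra.
by move: E2 => /eqP; rewrite x0 y0 z0 !mul0r !addr0 gt_eqF// mulr_gt0.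
Qed.

Lemma no_irrational_scale (a b : R) (x1 y1 z1 x2 y2 z2 x3 y3 z3 : nat) :
  0 < lam -> 0 < a -> 0 < b -> (0 < x1 + z1)%N ->
  lam = x1%:R + y1%:R * a + z1%:R * b ->
  lam * a = x2%:R + y2%:R * a + z2%:R * b ->
  lam * b = x3%:R + y3%:R * a + z3.+1%:R * b -> False.
Proof.
move=> l0 a0 b0 xz E1 E2 E3.
pose L := [:: [:: x1; y1; z1]; [:: x2; y2; z2]; [:: x3; y3; z3.+1]].
pose N : 'M[int]_3 := \matrix_(i, j) Posz (nth 0%N (nth [::] L j) i).
pose v : 'rV[R]_3 := \row_j nth 0 [:: 1; a; b] j.
have mulE (w : 'rV[R]_3) (j : 'I_3) : (w *m map_mx intr N) 0 j =
   w 0 0 * (nth 0%N (nth [::] L j) 0)%:R + w 0 1 * (nth 0%N (nth [::] L j) 1)%:R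
   + w 0 2%:R * (nth 0%N (nth [::] L j) 2)%:R.
  rewrite !mxE !big_ord_recl big_ord0 addr0 !mxE /= addrA.
  by congr (_ * _ + _ * _ + _ * _); congr (w _ _); apply: val_inj.
have [||u u0 uE] := @conj_eigenvector N v.
- by apply/eqP => /rowP/(_ 0); rewrite !mxE /=; apply/eqP; exact: oner_neq0.
- apply/rowP => j; rewrite mulE !mxE /=.
  by case: j => -[|[|[|j]]] //= Hj; lra.
have eqs (j : 'I_3) := congr1 (fun w : 'rV[R]_3 => w 0 j) uE.
have := eqs 0; have := eqs 1; have := eqs 2%:R; rewrite !mulE !mxE /=.
have {u0} : [\/ u 0 0 != 0, u 0 1 != 0 | u 0 2%:R != 0].
  apply: contrapT => H; case/eqP: u0; apply/rowP => j; rewrite mxE; apply/eqP.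
  apply: contrapT => /negP uj; apply: H; case: j uj => -[|[|[|j]]] //= Hj uj;
    [constructor 1|constructor 2|constructor 3]; move: uj;
    by congr (u _ _ != _); apply: val_inj.
move: (u 0 0) (u 0 1) (u 0 2%:R) => u1 u2 u3 {u uE eqs mulE v N L} u0 F3 F2 F1.
have max3 (x y z : R) : exists M, [/\ x <= M, y <= M, z <= M & [\/ x = M, y = M | z = M]].
  exists (Num.max x (Num.max y z)); split; rewrite ?le_max ?lexx ?orbT//.
  by case: (leP x _) => _; [case: leP => _; [constructor 3|constructor 2]|constructor 1].
have [M [M1 M2 M3 Mmax]] := max3 `|u1| (`|u2| / a) (`|u3| / b).
rewrite !ler_pdivrMr// in M2 M3.
have M0 : 0 < M.
  rewrite ltNge; apply/negP => M0; case: u0 => /eqP; apply; apply/normr0_eq0/eqP;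
    rewrite eq_le normr_ge0 andbT.
  - exact: le_trans M0.
  - by apply: le_trans M2 _; rewrite pmulr_lle0.
  - by apply: le_trans M3 _; rewrite pmulr_lle0.
have [n1 n2 n3] := no_extremal_entry l0 a0 b0 M0 xz E1 E2 E3 F1 F2 F3 M1 M2 M3.
have neg (w : R) (N1 N2 N3 : nat) :
    u1 * N1%:R + u2 * N2%:R + u3 * N3%:R = - lam * w ->
    - u1 * N1%:R + - u2 * N2%:R + - u3 * N3%:R = - lam * - w.
  by rewrite mulrN => <-; ring.
have [||||||n1' n2' n3'] := @no_extremal_entry M a b (- u1) (- u2) (- u3) _ _ _ _ _ _ _ _ _
  l0 a0 b0 M0 xz E1 E2 E3; rewrite ?normrN //; try exact: neg.
have absE (e M' : R) : `|e| = M' -> e = M' \/ - e = M'.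
  by case: (ger0P e) => _ <-; [left|right].
have scaled (x y : R) : 0 < y -> x / y = M -> x = M * y by move=> y0 <-; rewrite divfK// gt_eqF.
by case: Mmax => [|/(scaled _ _ a0)|/(scaled _ _ b0)] /absE[].
Qed.

End Spectrum.

(** If lam is rational and c is not, then a side of rational length carries no
   long base: comparing irrational parts in the length of the top side shows that
   a has a nonnegative irrational part, and a + 2c a positive one. *)
Lemma rational_no_long (R : realType) (c a lam : R) (x2 y2 z2 : nat) :
  0 < c -> 0 < a -> is_rat lam -> ~ is_rat c -> (0 < x2 + z2)%N ->
  lam * a = x2%:R + y2%:R * a + z2%:R * (a + 2 * c) ->
  forall rho, is_rat rho -> forall x y z : nat, rho <> x%:R + y%:R * a + z.+1%:R * (a + 2 * c).
Proof.
move=> c0 a0 lQ cI xz E rho rQ x y z F; apply: cI.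
pose m := lam - y2%:R - z2%:R.
have mE : m * a = x2%:R + 2 * z2%:R * c by rewrite /m; lra.
have ma : 0 < m * a.
  rewrite mE; have := ler0n R x2; have := ler0n R z2.
  move: xz; rewrite addn_gt0 => /orP[|]; rewrite -(ltr0n R) => ? ? ?; nra.
have m0 : 0 < m by rewrite pmulr_lgt0 in ma.
pose k := 2 * (y%:R + z.+1%:R) * z2%:R + 2 * z.+1%:R * m.
have k0 : 0 < k.
  apply: ltr_wpDl; last by apply: mulr_gt0 => //; rewrite mulr_gt0// ltr0n.
  by apply: mulr_ge0; rewrite ?ler0n// mulr_ge0// addr_ge0// ler0n.
have -> : c = (m * (rho - x%:R) - (y%:R + z.+1%:R) * x2%:R) / k.
  apply: (mulIf (lt0r_neq0 k0)); rewrite divfK ?gt_eqF//.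
  have := congr1 (fun t => (y%:R + z.+1%:R) * t) mE; rewrite /= F /k; lra.
have mQ : is_rat m by rewrite /m; do 2 (apply: is_ratD; last by apply/is_ratN/is_rat_nat).
apply: is_ratM.
  apply: is_ratD.
    by apply: is_ratM => //; apply: is_ratD => //; apply/is_ratN/is_rat_nat.
  by apply/is_ratN/is_ratM; [apply: is_ratD|]; exact: is_rat_nat.
apply/is_ratV/is_ratD; repeat apply: is_ratM => //;
  first [exact: is_rat_nat | by apply: is_ratD; exact: is_rat_nat].
Qed.

(** * Areas by counting *)

Lemma exp_bounded_le1 (R : realType) (x K : R) : 0 <= x ->
  (forall m : nat, x ^+ m <= K) -> x <= 1.
Proof.
move=> x0 H; rewrite leNgt; apply/negP => x1.
have lin (m : nat) : m%:R * (x - 1) <= x ^+ m.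
  elim: m => [|m IH]; first by rewrite mul0r.
  have e1 : 1 <= x ^+ m by rewrite exprn_ege1// ltW.
  by rewrite -natr1 exprS; nra.
have K0 : 0 <= K by rewrite (le_trans _ (H 0%N))// exprn_ge0.
have N0 : 0 <= K / (x - 1) by rewrite divr_ge0// subr_ge0 ltW.
have := archi_boundP N0; rewrite ltr_pdivrMr ?subr_gt0// => /lt_le_trans/(_ (lin _)).
by rewrite ltNge H.
Qed.

Section Counting.
Variables (R : realType) (c s a lam : R).
Hypotheses (c_gt0 : 0 < c) (s_gt0 : 0 < s) (a_gt0 : 0 < a) (lam_gt0 : 0 < lam).
Hypothesis cs1 : c * c + s * s = 1.
Variables (n : nat) (o d : 'I_n -> plane R).
Hypothesis n_ge2 : (2 <= n)%N.
Hypothesis d_unit : forall i, unit_vec (d i).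
Implicit Types (p q : plane R) (w : seq 'I_n).

Local Notation b := (base c a).
Local Notation big := (tile c s a lam 0 (1, 0)).
Local Notation big_in := (tile_in c s a lam 0 (1, 0)).
Local Notation copy i := (tile c s a 1 (o i) (d i)).
Local Notation copy_in i := (tile_in c s a 1 (o i) (d i)).
Hypothesis big_cover : forall p, big p <-> exists i, copy i p.
Hypothesis copy_disj : forall i j p, copy_in i p -> copy_in j p -> i = j.
Hypothesis copy_in_big : forall i p, copy_in i p -> big_in p.

Definition sqdist p q : R := (p.1 - q.1) ^+ 2 + (p.2 - q.2) ^+ 2.

Definition shrink i p := o i + rot (d i) (lam^-1 *: p).
Definition shrinks w p := foldr shrink p w.

Lemma shrink_gap i e p : gap_at c s a 1 (o i) (d i) e (shrink i p) =
  lam^-1 * gap_at c s a lam 0 (1, 0) e p.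
Proof.
have l0 : lam != 0 by rewrite gt_eqF.
rewrite /shrink /gap_at addrAC subrr add0r unrotK//.
by case: e; rewrite /gap /unrot /= /GRing.scale /=; field.
Qed.

Lemma shrink_tile i p : copy i (shrink i p) <-> big p.
Proof.
by split=> H e; have := H e; rewrite shrink_gap pmulr_rge0// invr_gt0.
Qed.

Lemma shrink_tile_in i p : copy_in i (shrink i p) <-> big_in p.
Proof.
by split=> H e; have := H e; rewrite shrink_gap pmulr_rgt0// invr_gt0.
Qed.

Lemma shrink_onto i q : exists p, q = shrink i p.
Proof.
exists (lam *: unrot (d i) (q - o i)); rewrite /shrink scalerA mulVf ?gt_eqF// scale1r rotK//.
by rewrite addrC subrK.
Qed.

Lemma shrink_dist i p q : sqdist (shrink i p) (shrink i q) = lam^-1 ^+ 2 * sqdist p q.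
Proof.
have := d_unit i; rewrite /unit_vec => d1.
rewrite -[RHS]mul1r -d1 /sqdist /shrink /rot /= /GRing.scale /=; ring.
Qed.

Lemma shrinks_onto w q : exists p, q = shrinks w p.
Proof.
elim: w q => [|i w IH] q; first by exists q.
by have [p ->] := shrink_onto i q; have [p' ->] := IH p; exists p'.
Qed.

Lemma shrinks_dist w p q :
  sqdist (shrinks w p) (shrinks w q) = (lam^-1 ^+ 2) ^+ size w * sqdist p q.
Proof.
elim: w => [|i w IH] /=; first by rewrite expr0 mul1r.
by rewrite shrink_dist IH [in RHS]exprS mulrA.
Qed.

Lemma shrinks_cover m p : big p -> exists w p', [/\ size w = m, big p' & p = shrinks w p'].
Proof.
elim: m p => [|m IH] p Hp; first by exists [::], p.
have [i Hi] := (big_cover p).1 Hp; have [q pE] := shrink_onto i p; subst p.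
have [w [p' [sw bp ->]]] := IH q ((shrink_tile i q).1 Hi).
by exists (i :: w), p'; rewrite /= sw.
Qed.

Lemma shrinks_in w p : big_in p -> big_in (shrinks w p).
Proof.
by elim: w => //= i w IH /IH H; apply: (copy_in_big (i := i)); apply/shrink_tile_in.
Qed.

Lemma sqdist_eq0 p q : sqdist p q = 0 -> p = q.
Proof.
rewrite /sqdist => /eqP; rewrite paddr_eq0 ?sqr_ge0// !sqrf_eq0 !subr_eq0.
by move=> /andP[/eqP ? /eqP ?]; apply: plane_eq.
Qed.

Lemma shrink_inj i p q : shrink i p = shrink i q -> p = q.
Proof.
move=> E; apply: sqdist_eq0; have : sqdist (shrink i p) (shrink i q) = 0.
  by rewrite E /sqdist !subrr expr0n addr0.
have k0 : lam^-1 ^+ 2 != 0 :> R by rewrite expf_neq0// invr_neq0// gt_eqF.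
by rewrite shrink_dist => /eqP; rewrite mulf_eq0 (negbTE k0) => /eqP.
Qed.

Lemma shrinks_disj w w' p p' : size w = size w' -> big_in p -> big_in p' ->
  shrinks w p = shrinks w' p' -> w = w'.
Proof.
elim: w w' => [|i w IH] [|j w'] //= [sw] Hp Hp' E.
have ij : i = j.
  apply: (copy_disj (p := shrink i (shrinks w p))); first exact/shrink_tile_in/shrinks_in.
  by rewrite E; exact/shrink_tile_in/shrinks_in.
by subst j; rewrite (IH w')//; exact: shrink_inj E.
Qed.

(* bounds the coordinates of the points of big *)
Local Notation L := (lam * (b + s)).

Lemma big_bounds p : big p -> [/\ 0 <= p.1, p.1 <= L, 0 <= p.2 & p.2 <= L].
Proof.
have s0 := s_gt0; have c0 := c_gt0; have l0 := lam_gt0; have b0 := b_gt0 c_gt0 a_gt0.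
have E v : unrot (1, 0) v = v by apply: plane_eq; rewrite /unrot /=; ring.
have ls := mulr_gt0 l0 s0; have lb := mulr_gt0 l0 b0.
move=> H; have := H Long; have := H LegL; have := H Short; have := H LegR.
rewrite /gap_at !E subr0 /gap => H4 H3 H2 H1.
have cy : 0 <= c * p.2 by rewrite mulr_ge0// ltW.
have x0 : 0 <= p.1 by have := (pmulr_rge0 p.1 s0); lra.
have x1 : 0 <= lam * b - p.1 by have := (pmulr_rge0 (lam * b - p.1) s0); lra.
by split; lra.
Qed.

Lemma big_center : exists p0 (rho : R), [/\ 0 < rho, big_in p0 &
  forall q, sqdist p0 q < rho ^+ 2 -> big_in q].
Proof.
have s0 := s_gt0; have c0 := c_gt0; have l0 := lam_gt0; have a0 := a_gt0; have cs := cs1.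
have E v : unrot (1, 0) v = v by apply: plane_eq; rewrite /unrot /=; ring.
pose t := Num.min 1 a; have t0 : 0 < t by rewrite lt_min ltr01.
have [t1 ta] : t <= 1 /\ t <= a by rewrite !ge_min !lexx orbT.
pose rho := lam * s * t / 4; pose p0 : plane R := (lam * b / 2, lam * s / 2).
have r0 : 0 < rho by rewrite /rho !mulr_gt0//; lra.
have near q : sqdist p0 q < rho ^+ 2 -> big_in q.
  move=> H.
  have dx : `|p0.1 - q.1| < rho.
    rewrite -(ltr_pXn2r (n := 2))// ?nnegrE ?(ltW r0)// real_normK ?num_real//.
    by apply: le_lt_trans H; rewrite lerDl sqr_ge0.
  have dy : `|p0.2 - q.2| < rho.
    rewrite -(ltr_pXn2r (n := 2))// ?nnegrE ?(ltW r0)// real_normK ?num_real//.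
    by apply: le_lt_trans H; rewrite lerDr sqr_ge0.
  move: dx dy; rewrite !ltr_norml /p0 /= => /andP[x1 x2] /andP[y1 y2].
  have [c1 s1] : c <= 1 /\ s <= 1 by split; nra.
  have lst := mulr_gt0 l0 s0.
  have h1 : lam * s * t <= lam * s by rewrite ger_pMr.
  have h2 : lam * s * t <= lam * s * a by rewrite ler_pM2l.
  have lsc := mulr_gt0 lst c0.
  have sx1 : s * (lam * b / 2 - q.1) < rho by nra.
  have sx2 : - rho < s * (lam * b / 2 - q.1) by nra.
  have cy1 : c * (lam * s / 2 - q.2) < rho by nra.
  have cy2 : - rho < c * (lam * s / 2 - q.2) by nra.
  rewrite /rho /base in x1 x2 y1 y2 sx1 sx2 cy1 cy2.
  by case; rewrite /gap_at E subr0 /gap /base; lra.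
exists p0, rho; split => //; apply: near.
by rewrite /sqdist !subrr expr0n /= addr0 exprn_gt0.
Qed.

(** Choosing an interior point in each of the n^m cells of the m-th subdivision
   gives n^m points at mutual distance at least of order lam^-m, since each cell
   contains a disc of that order around its point. *)
Lemma count_upper : exists2 C : R, 0 < C &
  forall m : nat, n%:R ^+ m <= (C * lam ^+ m + 1) ^+ 2.
Proof.
have [p0 [rho [r0 Hp0 near]]] := big_center.
have b0 := b_gt0 c_gt0 a_gt0; have L0 : 0 < L by rewrite mulr_gt0// addr_gt0.
exists (2 * L / rho); first by rewrite divr_gt0// mulr_gt0.
move=> m; have lm : 0 < lam ^+ m by rewrite exprn_gt0.
pose k := 2 * lam ^+ m / rho.
have k0 : 0 < k by rewrite divr_gt0// mulr_gt0.
have -> : 2 * L / rho * lam ^+ m = k * L by rewrite /k; ring.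
pose X := Num.truncn (k * L).
have trX (x : R) : 0 <= x -> x <= L -> (Num.truncn (k * x) < X.+1)%N.
  by move=> x0 x1; rewrite ltnS le_truncn// ler_pM2l.
pose F (w : m.-tuple 'I_n) : 'I_X.+1 * 'I_X.+1 :=
  (inord (Num.truncn (k * (shrinks w p0).1)), inord (Num.truncn (k * (shrinks w p0).2))).
have bnd (w : m.-tuple 'I_n) : [/\ 0 <= (shrinks w p0).1, (shrinks w p0).1 <= L,
    0 <= (shrinks w p0).2 & (shrinks w p0).2 <= L].
  by apply: big_bounds => e; apply: ltW; exact: shrinks_in.
have close (x y : R) : 0 <= x -> 0 <= y -> Num.truncn (k * x) = Num.truncn (k * y) ->
    (x - y) ^+ 2 <= (k^-1) ^+ 2.
  move=> x0 y0 E; have := truncn_itv (mulr_ge0 (ltW k0) x0).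
  have := truncn_itv (mulr_ge0 (ltW k0) y0); rewrite E -natr1 => /andP[? ?] /andP[? ?].
  rewrite -[X in X <= _]real_normK ?num_real// ler_pXn2r// ?nnegrE ?invr_ge0 ?(ltW k0)//.
  by rewrite -div1r ler_pdivlMr// -[X in _ * X](gtr0_norm k0) -normrM ler_norml; apply/andP; split; lra.
have Finj : injective F.
  move=> w w' [/(congr1 val) E1 /(congr1 val) E2].
  have [x0 x1 y0 y1] := bnd w; have [x0' x1' y0' y1'] := bnd w'.
  rewrite /= !inordK ?trX// in E1 E2.
  have D1 := close _ _ x0 x0' E1; have D2 := close _ _ y0 y0' E2.
  have [p1 E] := shrinks_onto w (shrinks w' p0).
  apply: val_inj; apply: (@shrinks_disj w w' p1 p0); rewrite ?size_tuple//.
  apply: near.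
  have : sqdist (shrinks w p0) (shrinks w' p0) <= 2 * (k^-1) ^+ 2 by rewrite /sqdist; lra.
  rewrite E shrinks_dist size_tuple -exprM mulnC exprM exprVn.
  have kE : k^-1 = rho * (lam ^+ m)^-1 / 2 by rewrite /k; field; rewrite !gt_eqF.
  rewrite kE.
  have li : 0 < (lam ^+ m)^-1 ^+ 2 by rewrite exprn_gt0// invr_gt0.
  have -> : 2 * (rho * (lam ^+ m)^-1 / 2) ^+ 2 = (lam ^+ m)^-1 ^+ 2 * (rho ^+ 2 / 2).
    by move: (lam ^+ m)^-1 => z; field.
  rewrite ler_pM2l// => /le_lt_trans; apply.
  have := exprn_gt0 2 r0; lra.
have := leq_card F Finj; rewrite card_tuple card_prod !card_ord => cardle.
apply: (@le_trans _ _ ((X.+1 * X.+1)%:R)); first by rewrite -natrX ler_nat.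
rewrite natrM expr2 -natr1.
have : X%:R <= k * L by have /andP[] := truncn_itv (mulr_ge0 (ltW k0) (ltW L0)).
have := ler0n R X; nra.
Qed.

(** A grid of spacing slightly larger than the diameter of the cells of the m-th
   subdivision has at most one point in each cell. *)
Lemma count_lower : exists2 C : R, 0 < C &
  forall m : nat, (lam ^+ 2) ^+ m <= C * n%:R ^+ m.
Proof.
have s0 := s_gt0; have c0 := c_gt0; have l0 := lam_gt0; have a0 := a_gt0.
have b0 := b_gt0 c_gt0 a_gt0; have L0 : 0 < L by rewrite mulr_gt0// addr_gt0.
have E v : unrot (1, 0) v = v by apply: plane_eq; rewrite /unrot /=; ring.
pose h := lam * Num.min a s; have h0 : 0 < h by rewrite mulr_gt0// lt_min a_gt0.
have [ha hs] : h <= lam * a /\ h <= lam * s by rewrite !ler_pM2l// !ge_min !lexx orbT.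
pose kap := h / (2 * L); have k0 : 0 < kap by rewrite divr_gt0// mulr_gt0.
exists (4 / kap ^+ 2); first by rewrite divr_gt0// exprn_gt0.
move=> m; have lm : 0 < lam ^+ m by rewrite exprn_gt0.
pose M := Num.truncn (kap * lam ^+ m); pose del := 2 * L / lam ^+ m.
have del0 : 0 < del by rewrite divr_gt0// mulr_gt0.
have /andP[M1 M2] := truncn_itv (ltW (mulr_gt0 k0 lm)).
have Mh : M%:R * del <= h.
  apply: (@le_trans _ _ (kap * lam ^+ m * del)); first by rewrite ler_pM2r.
  have aux (u v : R) : u != 0 -> v != 0 -> h / u * v * (u / v) = h.
    by move=> u0 v0; field; rewrite u0 v0.
  by rewrite /kap /del aux// gt_eqF// mulr_gt0.
pose g (jk : 'I_M * 'I_M) : plane R := (lam * c + jk.1%:R * del, jk.2%:R * del).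
have gbig jk : big (g jk).
  have jd (j : 'I_M) : 0 <= j%:R * del <= h.
    rewrite mulr_ge0 ?(ltW del0)//=; apply: le_trans Mh; rewrite ler_pM2r// ler_nat.
    exact: ltnW.
  have /andP[x0 x1] := jd jk.1; have /andP[y0 y1] := jd jk.2.
  move: x0 x1 y0 y1; rewrite /g => x0 x1 y0 y1.
  have cy : 0 <= c * (lam * s - jk.2%:R * del) by rewrite mulr_ge0 ?(ltW c0)// subr_ge0; lra.
  have sx := mulr_ge0 (ltW s0) x0.
  have sx' : 0 <= s * (lam * a - jk.1%:R * del) by rewrite mulr_ge0 ?(ltW s0)// subr_ge0; lra.
  by case; rewrite /gap_at E subr0 /gap /base /=; lra.
have /choice[F HF] : forall jk, exists w : m.-tuple 'I_n, exists2 p', big p' & g jk = shrinks w p'.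
  move=> jk; have [w [p' [sw bp pE]]] := shrinks_cover m (gbig jk).
  have sw' : size w == m by rewrite sw.
  by exists (Tuple sw'), p'.
have Finj : injective F.
  move=> jk jk' FE; have [p bp gE] := HF jk; have [p' bp' gE'] := HF jk'.
  have : sqdist (g jk) (g jk') < del ^+ 2.
    rewrite gE gE' FE shrinks_dist size_tuple -exprM mulnC exprM exprVn.
    have -> : del ^+ 2 = (lam ^+ m)^-1 ^+ 2 * (4 * L ^+ 2).
      by rewrite /del; move: (lam ^+ m)^-1 => z; ring.
    rewrite ltr_pM2l ?exprn_gt0 ?invr_gt0// /sqdist.
    have [x0 x1 y0 y1] := big_bounds bp; have [x0' x1' y0' y1'] := big_bounds bp'.
    have sq (x y : R) : 0 <= x -> x <= L -> 0 <= y -> y <= L -> (x - y) ^+ 2 <= L ^+ 2.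
      move=> *; rewrite -[X in X <= _]real_normK ?num_real// ler_pXn2r ?nnegrE ?(ltW L0)//.
      by rewrite ler_norml; apply/andP; split; lra.
    have := sq _ _ x0 x1 x0' x1'; have := sq _ _ y0 y1 y0' y1'; have := exprn_gt0 2 L0; lra.
  rewrite /sqdist /g /= => H.
  have eqn (j j' : 'I_M) : ((j%:R - j'%:R) * del) ^+ 2 < del ^+ 2 -> j = j'.
    rewrite exprMn gtr_pMl ?exprn_gt0// => lt1; apply: val_inj.
    have : `|j%:R - j'%:R : R| < 1.
      by rewrite -(ltr_pXn2r (n := 2))// ?nnegrE// real_normK ?num_real// expr1n.
    rewrite ltr_norml => /andP[h1 h2].
    have h1' : (j'%:R : R) < j.+1%:R by rewrite -natr1; lra.
    have h2' : (j%:R : R) < j'.+1%:R by rewrite -natr1; lra.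
    by rewrite !ltr_nat !ltnS in h1' h2'; apply/eqP; rewrite eqn_leq h1' h2'.
  rewrite [jk]surjective_pairing [jk']surjective_pairing; congr pair; apply: eqn;
    apply: le_lt_trans H.
    by rewrite [X in X <= _](_ : _ = (lam * c + jk.1%:R * del - (lam * c + jk'.1%:R * del)) ^+ 2) ?lerDl ?sqr_ge0//; ring.
  by rewrite [X in X <= _](_ : _ = (jk.2%:R * del - jk'.2%:R * del) ^+ 2) ?lerDr ?sqr_ge0//; ring.
have := leq_card F Finj; rewrite card_tuple card_prod !card_ord => cardle.
have n1 : 1 <= n%:R ^+ m :> R by rewrite exprn_ege1// ler1n ltnW.
have MM : (M%:R : R) * M%:R <= n%:R ^+ m by rewrite -natrM -natrX ler_nat.
rewrite -exprM mulnC exprM -[4 / _ * _]mulrAC ler_pdivlMr ?exprn_gt0// mulrC -exprMn.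
move: M2 MM n1; rewrite -natr1; have := ler0n R M; move: (mulr_gt0 k0 lm).
move: (kap * lam ^+ m) (n%:R ^+ m) (M%:R : R) => u v w u0 w0 uw ww v1.
have : u * u <= (w + 1) * (w + 1) by apply: ler_pM; lra.
have := sqr_ge0 (w - 1); lra.
Qed.

Theorem scale_square : lam ^+ 2 = n%:R.
Proof.
have l0 := lam_gt0; have n0 : 0 < n%:R :> R by rewrite ltr0n ltnW.
have l2 : 0 < lam ^+ 2 by rewrite exprn_gt0.
have le1 : lam ^+ 2 <= n%:R.
  have [C C0 H] := count_lower.
  suff : lam ^+ 2 / n%:R <= 1 by rewrite ler_pdivrMr// mul1r.
  apply: (exp_bounded_le1 (K := C)); first by rewrite divr_ge0// ltW.
  by move=> m; rewrite expr_div_n ler_pdivrMr ?exprn_gt0.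
apply/eqP; rewrite eq_le le1 /=.
have [C C0 H] := count_upper.
pose mu := Num.max 1 (lam ^+ 2).
have mu1 : 1 <= mu by rewrite le_max lexx.
have mu0 : 0 < mu by rewrite (lt_le_trans ltr01).
have : n%:R <= mu.
  suff : n%:R / mu <= 1 by rewrite ler_pdivrMr// mul1r.
  apply: (exp_bounded_le1 (K := (C + 1) ^+ 2)); first by rewrite divr_ge0// ltW.
  move=> m; rewrite expr_div_n ler_pdivrMr ?exprn_gt0//; apply: le_trans (H m) _.
  have lm : 0 < lam ^+ m by rewrite exprn_gt0.
  have m1 : 1 <= mu ^+ m by rewrite exprn_ege1.
  have m2 : lam ^+ m * lam ^+ m <= mu ^+ m.
    rewrite -expr2 -exprM mulnC exprM; apply: lerXn2r; rewrite ?nnegrE ?(ltW l2) ?(ltW mu0)//.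
    by rewrite le_max lexx orbT.
  have m3 : lam ^+ m <= mu ^+ m by nra.
  have := mulr_gt0 C0 C0; nra.
rewrite le_max => /orP[|//]; rewrite lern1.
by move: n_ge2; case: (n) => [|[|]].
Qed.

End Counting.

(** * A tiling near a point *)

Lemma soon_sides (R : realType) (P : side -> R -> Prop) :
  (forall e, soon (P e)) -> soon (fun x => forall e, P e x).
Proof.
move=> H; apply: soon_imp (soon_and (soon_and (H Long) (H LegL)) (soon_and (H Short) (H LegR))).
by move=> x _ [[? ?] [? ?]] [].
Qed.

Section Tiling.
Variables (R : realType) (c s a lam : R).
Hypotheses (c_gt0 : 0 < c) (s_gt0 : 0 < s) (a_gt0 : 0 < a) (lam_gt1 : 1 < lam).
Hypothesis cs1 : c * c + s * s = 1.
Variables (n : nat) (o d : 'I_n -> plane R).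
Hypothesis d_unit : forall i, unit_vec (d i).
Implicit Types (p q r v : plane R) (i j : 'I_n).

Local Notation b := (base c a).
Local Notation len := (len c a).
Local Notation big := (tile c s a lam 0 (1, 0)).
Local Notation big_in := (tile_in c s a lam 0 (1, 0)).
Local Notation copy i := (tile c s a 1 (o i) (d i)).
Local Notation copy_in i := (tile_in c s a 1 (o i) (d i)).
Local Notation bgerm := (germ c s a lam 0 (1, 0)).
Local Notation cgerm i := (germ c s a 1 (o i) (d i)).
Local Notation dir := (dir c s).
Local Notation corner := (corner c s a).
Local Notation b_gt0 := (b_gt0 c_gt0 a_gt0).
Local Notation lenp := (len_gt0 c_gt0 a_gt0).

Hypothesis big_cover : forall p, big p <-> exists i, copy i p.
Hypothesis copy_disj : forall i j p, copy_in i p -> copy_in j p -> i = j.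

Lemma copy_big i p : copy i p -> big p.
Proof. by move=> ?; apply/big_cover; exists i. Qed.

Lemma tile_in_near l (o' d' : plane R) p v :
  tile_in c s a l o' d' p -> soon (fun e => tile_in c s a l o' d' (p + e *: v)).
Proof.
move=> H; apply: soon_sides => e; have [|e0 e00 He0] := @soon_gt0 _
  (gap_at c s a l o' d' e p) (slope c s e (unrot d' v)); first by left; exact: H.
by exists e0 => // x /He0; rewrite gap_atD.
Qed.

Definition blocked p := forall i, ~ copy_in i p.

(** Moving p slightly towards the centre of the first copy brings it inside both. *)
Lemma copy_in_uniq i j p : copy i p -> copy_in j p -> i = j.
Proof.
move=> Hi Hj; pose m : plane R := o i + rot (d i) (b / 2, s / 2).
have [e e0 [H1 H2]] : exists2 e, 0 < e & copy_in j (p + e *: (m - p)) /\ e < 1.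
  by apply: soon_ex; apply: soon_and; [exact: tile_in_near|exact: soon_lt].
apply: (copy_disj (p := p + e *: (m - p))) => // k.
have -> : gap_at c s a 1 (o i) (d i) k (p + e *: (m - p)) =
  (1 - e) * gap_at c s a 1 (o i) (d i) k p + e * gap c s a 1 k (b / 2, s / 2).
  rewrite -[in RHS](unrotK (b / 2, s / 2) (d_unit i)) /m.
  by case: k; rewrite /gap_at /gap /unrot /rot /= /GRing.scale /=; ring.
rewrite ltr_wpDl//; first by rewrite mulr_ge0 ?Hi// subr_ge0 ltW.
apply: mulr_gt0 => //; have sc : 0 < s * c by rewrite mulr_gt0.
have sa : 0 < s * a by rewrite mulr_gt0.
by have s0 := s_gt0; case: k; rewrite /gap /base /=; lra.
Qed.

Lemma blocked_copy i p : copy i p -> ~ copy_in i p -> blocked p.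
Proof. by move=> Hi ni j Hj; apply: ni; rewrite (copy_in_uniq Hi Hj). Qed.

Lemma blocked_big p : ~ big_in p -> blocked p.
Proof.
move=> np i Hi; apply: np => e; rewrite ltNge; apply/negP => g0.
have [v sv] : exists v, slope c s e (unrot (1, 0) v) < 0.
  by case: (e); [exists (0, -1)|exists (-1, 0)|exists (0, 1)|exists (1, 0)];
    rewrite /slope /unrot /=; have := s_gt0; lra.
have [x x0 /tile_inW/copy_big/(_ e)] := soon_ex (tile_in_near v Hi).
rewrite gap_atD leNgt => /negP; apply.
by rewrite -[X in _ < X]addr0 ler_ltD// pmulr_rlt0.
Qed.

Lemma germ_uniq i j p r : cgerm i p r -> cgerm j p r -> i = j.
Proof.
move=> Hi Hj.
pose tr i e := (gap_at c s a 1 (o i) (d i) e p, slope c s e (unrot (d i) r),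
  slope c s e (unrot (d i) (right_of r))).
have [del [eps [d0 e0 H]]] := lexpos_realize
  [:: tr i Long; tr i LegL; tr i Short; tr i LegR;
      tr j Long; tr j LegL; tr j Short; tr j LegR].
apply: (copy_disj (p := p + eps *: (r + del *: right_of r))) => e;
  rewrite gap_atD unrotD slope_lin.
  by apply: (H (tr i e)); [case: (e); rewrite !inE eqxx ?orbT|exact: Hi].
by apply: (H (tr j e)); [case: (e); rewrite !inE eqxx ?orbT|exact: Hj].
Qed.

Lemma germ_cover p r : unit_vec r -> bgerm p r -> exists i, cgerm i p r.
Proof.
move=> r1 Hb; apply: contrapT => /forallNP H.
have {H} /choice[f Hf] : forall i, exists e, ~ lexpos
    (gap_at c s a 1 (o i) (d i) e p, slope c s e (unrot (d i) r),
  slope c s e (unrot (d i) (right_of r))).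
  by move=> i; apply/existsNP; exact: H.
pose tb e := (gap_at c s a lam 0 (1, 0) e p, slope c s e (unrot (1, 0) r),
  slope c s e (unrot (1, 0) (right_of r))).
pose tr i := (- gap_at c s a 1 (o i) (d i) (f i) p, - slope c s (f i) (unrot (d i) r),
  - slope c s (f i) (unrot (d i) (right_of r))).
have [del [eps [d0 e0 H]]] := lexpos_realize
  ([:: tb Long; tb LegL; tb Short; tb LegR] ++ [seq tr i | i <- enum 'I_n]).
have /big_cover[i] : big (p + eps *: (r + del *: right_of r)).
  move=> e; rewrite gap_atD unrotD slope_lin; apply/ltW.
  apply: (H (tb e)); last exact: Hb.
  by rewrite mem_cat; apply/orP; left; case: (e); rewrite !inE eqxx ?orbT.
move/(_ (f i)); rewrite gap_atD unrotD slope_lin leNgt => /negP; apply.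
rewrite -oppr_gt0 opprD -mulrN opprD -mulrN.
apply: (H (tr i)).
  by rewrite mem_cat; apply/orP; right; apply: map_f; rewrite mem_enum.
apply: lexposN (Hf i) => /=; rewrite slope_right.
by apply: slope_neq0 => //; exact: unit_unrot.
Qed.

Lemma edge_germ i e p r t : dir (d i) e = r -> p = corner (o i) (d i) e + t *: r ->
  0 <= t < len e -> cgerm i p r.
Proof.
move=> <- -> t01 e'; rewrite slope_right /dir unrotK//.
have -> : gap_at c s a 1 (o i) (d i) e' (corner (o i) (d i) e + t *: rot (d i) (ldir c s e)) =
  gap c s a 1 e' (lcorner c s a e + t *: ldir c s e).
  rewrite gap_atD unrotK// /corner /gap_at addrAC subrr add0r unrotK//.
  by case: e' => /=; rewrite /GRing.scale /=; ring.
exact: local_germ.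
Qed.

Lemma edge_pt i e t : 0 <= t <= len e ->
  copy i (corner (o i) (d i) e + t *: dir (d i) e) /\
  ~ copy_in i (corner (o i) (d i) e + t *: dir (d i) e).
Proof.
move=> /andP[t0 t1].
have E e' : gap_at c s a 1 (o i) (d i) e' (corner (o i) (d i) e + t *: dir (d i) e) =
  gap c s a 1 e' (lcorner c s a e + t *: ldir c s e).
  rewrite gap_atD /dir unrotK// /corner /gap_at addrAC subrr add0r unrotK//.
  by case: e' => /=; rewrite /GRing.scale /=; ring.
split=> [e'|/(_ e)]; rewrite E.
  have c0 := c_gt0; have s0 := s_gt0; have a0 := a_gt0.
  have sc0 : 0 < s * c by rewrite mulr_gt0.
  have sa0 : 0 < s * a by rewrite mulr_gt0.
  by move: t1; case: e {E} => /= t1; case: e' => /=; rewrite /base /GRing.scale /= in t1 *; nra.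
by case: e {E t1} => /=; rewrite /base /GRing.scale /=; lra.
Qed.

(** The copy that contains the directions just to the right of r does not contain r
   in its interior, so one of its sides lies along r. *)
Lemma edge_through p r : unit_vec r -> bgerm p r ->
  soon (fun x => blocked (p + x *: r)) ->
  exists i e t, [/\ dir (d i) e = r, p = corner (o i) (d i) e + t *: r & 0 <= t < len e].
Proof.
move=> r1 Hb Hbl; have [i Hi] := germ_cover r1 Hb.
have [e0 [g0 s0]] : exists e, gap_at c s a 1 (o i) (d i) e p <= 0 /\
   slope c s e (unrot (d i) r) <= 0.
  apply: contrapT => /forallNP H.
  have : soon (fun x => copy_in i (p + x *: r)).
    apply: soon_sides => e.
    have [|x x0 Hx] := @soon_gt0 R (gap_at c s a 1 (o i) (d i) e p) (slope c s e (unrot (d i) r)).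
      have [g0|g0] := ltP 0 (gap_at c s a 1 (o i) (d i) e p); [by left|right].
      have gE : gap_at c s a 1 (o i) (d i) e p = 0.
        by case: (Hi e) => /= [|[]|[]] //; rewrite ltNge g0.
      by split => //; rewrite ltNge; apply/negP => s0; case: (H e).
    by exists x => // y /Hx; rewrite gap_atD.
  by move=> /(soon_and Hbl) /soon_ex [x _ [/(_ i)]].
have [e [t [u1 u2 t01]]] := local_edge c_gt0 s_gt0 a_gt0 cs1 (unit_unrot (d_unit i) r1)
  (fun e => eq_ind _ (fun z => lexpos (_, _, z)) (Hi e) _ (slope_right c s (d i) e r)) g0 s0.
exists i, e, t; split => //; first by rewrite /dir -u1 rotK.
rewrite /corner -[p](subrK (o i)) addrC -addrA; congr (_ + _).
rewrite -[LHS](rotK _ (d_unit i)) u2 -[r](rotK _ (d_unit i)) u1.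
by apply: plane_eq; rewrite /rot /= /GRing.scale /=; ring.
Qed.

Lemma dir_unit v e : unit_vec v -> unit_vec (dir v e).
Proof.
rewrite /dir /unit_vec /rot /= => v1.
transitivity ((v.1 * v.1 + v.2 * v.2) * ((ldir c s e).1 * (ldir c s e).1 + (ldir c s e).2 * (ldir c s e).2)).
  by case: (e) => /=; ring.
by rewrite v1 mul1r; have := cs1; case: e => /=; lra.
Qed.

(** * Walking along a side *)

Definition edge_from i e p r := dir (d i) e = r /\ corner (o i) (d i) e = p.

(** This lets a walk along a line proceed from p: a side in direction r that is found
   at p starts there. *)
Definition no_straddle p r := forall i e t,
  dir (d i) e = r -> p = corner (o i) (d i) e + t *: r -> 0 <= t < len e -> t = 0.

Lemma no_straddle_out p r :
  soon (fun x => forall i, copy i (p - x *: r) -> copy_in i (p - x *: r)) ->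
  no_straddle p r.
Proof.
move=> H i e t de pE /andP[t0 t1]; rewrite pE in H; apply: contrapT => tn.
have {tn}t0 : 0 < t by rewrite lt_neqAle t0 andbT eq_sym; apply/eqP.
have [x x0 [xt]] := soon_ex (soon_and (soon_lt t0) H).
have [|H1 H2] := @edge_pt i e (t - x); first by apply/andP; split; lra.
move=> /(_ i); rewrite -addrA -scalerBl -de => K; exact: H2 (K H1).
Qed.

Lemma no_straddle_after i e p r : edge_from i e p r -> no_straddle (p + len e *: r) r.
Proof.
move=> [de ce] j e' t de' pE /andP[t0 t1]; apply: contrapT => tn.
have {tn}t0 : 0 < t by rewrite lt_neqAle t0 andbT eq_sym; apply/eqP.
(* just before p the two sides overlap, so they belong to the same copy *)
have [x x0 [xt xe]] := soon_ex (soon_and (soon_lt t0) (soon_lt (lenp e))).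
have g1 : cgerm i (p + (len e - x) *: r) r.
  by apply: (@edge_germ i e _ _ (len e - x)) => //; [rewrite ce|apply/andP; split; lra].
have g2 : cgerm j (p + (len e - x) *: r) r.
  apply: (@edge_germ j e' _ _ (t - x)) => //; last by apply/andP; split; lra.
  by rewrite [in RHS]scalerBl [RHS]addrA -pE scalerBl addrA.
have ij := germ_uniq g1 g2; subst j.
have ee : e = e'.
  move: de'; rewrite -de /dir => /(congr1 (unrot (d i))); rewrite !unrotK//.
  have c0 := c_gt0; have s0 := s_gt0.
  by case: e {de ce xe pE g1 g2}; case: e' {t1} => //= E; exfalso; case: E; lra.
subst e'; move: pE; rewrite ce => /addrI /(congr1 (fun v => v.1 * r.1 + v.2 * r.2)).
have r1 : unit_vec r by rewrite -de; exact: dir_unit.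
rewrite /= /GRing.scale /= -![len e * _ * _]mulrA -![t * _ * _]mulrA -!mulrDr r1 !mulr1.
lra.
Qed.

(** A segment of length l along which the copies to its right line up. The last
   clause holds when the points just beyond the end are interior to a copy or
   outside the large trapezoid; it keeps sides from reaching beyond the end. *)
Definition free_side p r (l : R) := [/\ unit_vec r,
  forall t, 0 <= t < l -> bgerm (p + t *: r) r,
  forall t, 0 < t < l -> blocked (p + t *: r) &
  soon (fun x => forall i, copy i (p + (l + x) *: r) -> copy_in i (p + (l + x) *: r))].

Lemma shiftD p r (t u : R) : p + t *: r + u *: r = p + (t + u) *: r.
Proof. by rewrite -addrA -scalerDl. Qed.

Lemma side_blocked p r (l t : R) : free_side p r l -> 0 <= t < l ->
  soon (fun x => blocked (p + t *: r + x *: r)).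
Proof.
move=> [_ _ H _] /andP[t0 tl]; exists ((l - t) / 2); first lra.
by move=> x /andP[x0 xl]; rewrite shiftD; apply: H; apply/andP; split; lra.
Qed.

Lemma side_stop p r (l t : R) i e : free_side p r l -> 0 <= t < l ->
  edge_from i e (p + t *: r) r -> t + len e <= l.
Proof.
move=> [_ _ _ H] /andP[t0 tl] [de ce]; rewrite leNgt; apply/negP => lt_.
have [|x x0 [xt]] := soon_ex (soon_and (@soon_lt _ (t + len e - l) _) H); first lra.
have [|H1 H2] := @edge_pt i e (l + x - t); first by apply/andP; split; lra.
have E : corner (o i) (d i) e + (l + x - t) *: dir (d i) e = p + (l + x) *: r.
  by rewrite ce de shiftD; congr (_ + _ *: _); ring.
by move/(_ i); rewrite -E => /(_ H1).
Qed.

Lemma side_step p r (l t : R) : free_side p r l -> 0 <= t < l ->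
  no_straddle (p + t *: r) r ->
  exists i e, [/\ edge_from i e (p + t *: r) r, t + len e <= l &
    no_straddle (p + (t + len e) *: r) r].
Proof.
move=> fs t0 ns; have [r1 Hg _ _] := fs.
have [i [e [u [de ce u0]]]] := edge_through r1 (Hg _ t0) (side_blocked fs t0).
have uz := ns _ _ _ de ce u0; subst u.
have ef : edge_from i e (p + t *: r) r by rewrite /edge_from de ce scale0r addr0.
exists i, e; split => //; first exact: side_stop ef.
by rewrite -shiftD; exact: no_straddle_after ef.
Qed.

Lemma side_walk p r (l t : R) : free_side p r l -> 0 <= t < l ->
  no_straddle (p + t *: r) r ->
  exists i e (u : R) (x y z : nat), [/\ edge_from i e (p + u *: r) r, u + len e = l &
    u = t + (x%:R + y%:R * a + z%:R * b)].
Proof.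
(* all sides are at least m long, which bounds the number of steps *)
move=> fs; pose m := Num.min 1 a.
have m0 : 0 < m by rewrite lt_min ltr01.
have lm e : m <= len e.
  case: e => /=; rewrite ge_min ?lexx ?orbT//.
  by apply/orP; right; rewrite /base; have := c_gt0; lra.
move=> tl; have [N] : exists N : nat, l - t < N%:R * m.
  exists (Num.bound ((l - t) / m)); rewrite -ltr_pdivrMr//.
  by apply: archi_boundP; rewrite divr_ge0 ?(ltW m0)// subr_ge0 ltW//; case/andP: tl.
elim: N t tl => [|N IH] t t0 lN ns.
  by exfalso; move: t0 lN; rewrite mul0r => /andP[]; lra.
have [i [e [ef tl ns']]] := side_step fs t0 ns.
have /andP[t0' _] := t0.
have [tE|tE] := eqVneq (t + len e) l.
  exists i, e, t, 0%N, 0%N, 0%N; split => //; ring.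
have [||j [e' [u [x [y [z [H1 H2 H3]]]]]]] := IH (t + len e) _ _ ns'.
- by rewrite lt_neqAle tE tl andbT addr_ge0// ltW// lenp.
- by have := lm e; move: lN; rewrite -natr1 mulrDl mul1r; lra.
exists j, e', u.
have [x1 [y1 [z1 E]]] : exists x y z : nat, len e = x%:R + y%:R * a + z%:R * b.
  by case: (e); [exists 0%N, 0%N, 1%N|exists 1%N, 0%N, 0%N|exists 0%N, 1%N, 0%N|exists 1%N, 0%N, 0%N] => /=; ring.
by exists (x1 + x)%N, (y1 + y)%N, (z1 + z)%N; split => //; rewrite H3 E !natrD; ring.
Qed.

Lemma side_length p r (l t : R) : free_side p r l -> 0 <= t <= l ->
  no_straddle (p + t *: r) r ->
  exists x y z : nat, l = t + (x%:R + y%:R * a + z%:R * b).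
Proof.
move=> fs /andP[t0]; rewrite le_eqVlt => /orP[/eqP -> _|tl ns].
  by exists 0%N, 0%N, 0%N; ring.
have [|i [e [u [x [y [z [_ <- ->]]]]]]] := side_walk fs _ ns; first by rewrite t0.
by case: e; [exists x, y, z.+1|exists x.+1, y, z|exists x, y.+1, z|exists x.+1, y, z];
  rewrite -natr1 /=; ring.
Qed.

Lemma side_first p r (l t : R) i e : free_side p r l -> 0 <= t < l ->
  edge_from i e (p + t *: r) r ->
  exists x y z : nat, l = t + len e + (x%:R + y%:R * a + z%:R * b).
Proof.
move=> fs t0 ef; apply: (side_length (t := t + len e) fs).
  rewrite (side_stop fs t0 ef) andbT addr_ge0//; first by case/andP: t0.
  exact: ltW (lenp e).
by rewrite -shiftD; exact: (no_straddle_after ef).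
Qed.

Lemma gap_at_rot i e q : gap_at c s a 1 (o i) (d i) e (o i + rot (d i) q) = gap c s a 1 e q.
Proof.
by rewrite /gap_at addrAC subrr add0r unrotK.
Qed.

Lemma rot_lin v q w (t : R) : rot v (q + t *: w) = rot v q + t *: rot v w.
Proof. by apply: plane_eq; rewrite /rot /= /GRing.scale /=; ring. Qed.

Lemma soon_copy_in i p w q v : p = o i + rot (d i) q -> w = rot (d i) v ->
  (forall e, 0 < gap c s a 1 e q \/ gap c s a 1 e q = 0 /\ 0 < slope c s e v) ->
  soon (fun x => copy_in i (p + x *: w)).
Proof.
move=> -> -> H; apply: soon_sides => e; have [x x0 Hx] := soon_gt0 (H e).
exists x => // y /Hx; rewrite -addrA -rot_lin gap_at_rot.
by case: (e); rewrite /gap /slope /= /GRing.scale /=; lra.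
Qed.

Lemma soon_contra p w i : soon (fun x => blocked (p + x *: w)) ->
  soon (fun x => copy_in i (p + x *: w)) -> False.
Proof. by move=> H1 H2; have [x _ [/(_ i)]] := soon_ex (soon_and H1 H2). Qed.

(** The angle between r and the second blocked ray is the acute angle of the
   copies: an obtuse corner does not fit into it. *)
Lemma wedge p r : unit_vec r -> bgerm p r ->
  soon (fun x => blocked (p + x *: r)) ->
  soon (fun x => blocked (p + x *: rot r (c, - s))) ->
  no_straddle p r ->
  exists i, edge_from i LegL p r \/ edge_from i Long p r.
Proof.
move=> r1 Hg Hb1 Hb2 ns.
have [i [e [u [de ce u0]]]] := edge_through r1 Hg Hb1.
have uz := ns _ _ _ de ce u0; subst u; move: ce; rewrite scale0r addr0 => ce.
have sa : 0 < s * a by rewrite mulr_gt0.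
have sc : 0 < s * c by rewrite mulr_gt0.
have s0 := s_gt0; have a0 := a_gt0; have c0 := c_gt0.
exists i; case: e de ce {u0} => de ce; [by right|by left| |]; exfalso;
  apply: (soon_contra Hb2).
  apply: (@soon_copy_in i _ _ (c, s) (c, - s)); [by rewrite ce| |].
    by rewrite -de; apply: plane_eq; rewrite /dir /rot /=; ring.
  by case; rewrite /gap /slope /base /=; [left|right|right|left]; try split; lra.
apply: (@soon_copy_in i _ _ (c + a, s) (c * c - s * s, - (2 * c * s))); [by rewrite ce| |].
  by rewrite -de; apply: plane_eq; rewrite /dir /rot /=; ring.
case; rewrite /gap /slope /base /=; [left|left|right|right]; try split; try lra.
have : 0 < s * (c * c + s * s) by rewrite cs1 mulr1.
lra.
Qed.

Lemma big_germ p r : (forall e, lexpos (gap c s a lam e p, slope c s e r,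
  slope c s e (right_of r))) -> bgerm p r.
Proof.
have E v : unrot (1, 0) v = v by apply: plane_eq; rewrite /unrot /=; ring.
by move=> H e; rewrite /gap_at !E subr0; exact: H.
Qed.

Lemma big_gap p e : gap_at c s a lam 0 (1, 0) e p = gap c s a lam e p.
Proof.
have E v : unrot (1, 0) v = v by apply: plane_eq; rewrite /unrot /=; ring.
by rewrite /gap_at E subr0.
Qed.

Lemma edge_from_frame i e p r : edge_from i e p r ->
  d i = rot r ((ldir c s e).1, - (ldir c s e).2) /\ o i = p - rot (d i) (lcorner c s a e).
Proof.
move=> [de ce]; split; last by rewrite -ce /corner addrK.
move: de; rewrite /dir => <-.
have : unit_vec (ldir c s e) by rewrite /unit_vec; have := cs1; case: (e) => /=; lra.
rewrite /unit_vec => l1.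
apply: plane_eq => /=.
  transitivity ((d i).1 * ((ldir c s e).1 * (ldir c s e).1 + (ldir c s e).2 * (ldir c s e).2)).
    by rewrite l1 mulr1.
  ring.
transitivity ((d i).2 * ((ldir c s e).1 * (ldir c s e).1 + (ldir c s e).2 * (ldir c s e).2)).
  by rewrite l1 mulr1.
ring.
Qed.

Local Notation zeta := ((c, s) : plane R).

Lemma zeta_unit : unit_vec zeta.
Proof. exact: cs1. Qed.

(** * The sides of the large trapezoid *)

(** The line through (X, 0) parallel to the left leg. *)
Definition slant (X t : R) : plane R := (X + t * c, t * s).

Lemma slantE X t : slant X t = (X, 0) + t *: zeta.
Proof. by apply: plane_eq; rewrite /slant /= /GRing.scale /=; ring. Qed.

(** Besides the left leg, for X = 0, this applies to the right sides of columns. *)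
Lemma slant_side X : 0 <= X <= lam * a ->
  (forall t, 0 < t < lam -> blocked (slant X t)) ->
  free_side (X, 0) zeta lam.
Proof.
have s0 := s_gt0; have a0 := a_gt0; have c0 := c_gt0; have cs := cs1; have l1 := lam_gt1.
have sc : 0 < s * c by rewrite mulr_gt0.
move=> /andP[X0 XA] H; split; first exact: cs1.
- move=> t /andP[t0 tl]; rewrite -slantE; apply: big_germ.
  case; rewrite /gap /slope /slant /right_of /lexpos /base /=.
  + move: t0; rewrite le_eqVlt => /orP[/eqP <-|t0].
      by constructor 2; split; lra.
    by constructor 1; rewrite mulr_gt0.
  + move: X0; rewrite le_eqVlt => /orP[/eqP <-|X0].
      by constructor 3; split; lra.
    constructor 1; have : 0 < s * X by rewrite mulr_gt0.
    lra.
  + constructor 1; have : 0 < (lam - t) * s by rewrite mulr_gt0 ?subr_gt0.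
    lra.
  + constructor 1; have : 0 < (lam - t) * (s * c) by rewrite mulr_gt0 ?subr_gt0.
    have : 0 <= s * (lam * a - X) by rewrite mulr_ge0 ?subr_ge0// ltW.
    lra.
- by move=> t /H; rewrite -slantE.
- apply: soon_all => x x0 i /copy_big /(_ Short); rewrite big_gap /gap /= /GRing.scale /=.
  have : 0 < x * s by rewrite mulr_gt0.
  lra.
Qed.

(** The acute corner of the large trapezoid is an acute corner of a copy, which has a
   leg or its long base on the left leg. *)
Lemma left_leg_lengths : exists x y z : nat,
  lam = x%:R + y%:R * a + z%:R * b /\ (0 < x + z)%N.
Proof.
have a0 := a_gt0; have l1 := lam_gt1; have s0 := s_gt0; have c0 := c_gt0.
have X0 : 0 <= (0 : R) <= lam * a by rewrite lexx/= mulr_ge0//; lra.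
have Hb t : 0 < t < lam -> blocked (slant 0 t).
  move=> _; apply: blocked_big => /(_ LegL).
  by rewrite big_gap /gap /slant /=; lra.
have fs := slant_side X0 Hb; have [_ fs1 _ _] := fs.
have t0 : 0 <= (0 : R) < lam by rewrite lexx/=; lra.
have [||||i] := @wedge ((0, 0) + 0 *: zeta) zeta zeta_unit.
- exact: fs1.
- exact: side_blocked fs t0.
- apply: soon_all => x x0; apply: blocked_big => /(_ Long).
  by rewrite big_gap /gap /rot /= /GRing.scale /=; lra.
- apply: no_straddle_out; apply: soon_all => x x0 i /copy_big/(_ Long).
  rewrite big_gap /gap /= /GRing.scale /=.
  have : 0 < x * s by rewrite mulr_gt0.
  lra.
by case=> /(side_first fs t0)[x [y [z E]]]; [exists x.+1, y, z|exists x, y, z.+1];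
  rewrite [LHS]E -natr1 /= ?addnS; split => //; ring.
Qed.

(** Two short bases cannot follow each other, because obtuse angles do not fit side
   by side; and one does not cover the top side, because lam > 1. *)
Lemma top_lengths : exists x y z : nat,
  lam * a = x%:R + y%:R * a + z%:R * b /\ (0 < x + z)%N.
Proof.
have a0 := a_gt0; have l1 := lam_gt1; have s0 := s_gt0; have c0 := c_gt0.
have sc : 0 < s * c by rewrite mulr_gt0.
have sa : 0 < s * a by rewrite mulr_gt0.
pose p : plane R := (lam * c, lam * s); pose r : plane R := (1, 0).
have fs : free_side p r (lam * a).
  split.
  - by rewrite /unit_vec /=; lra.
  - move=> t /andP[t0 tl]; apply: big_germ.
    case; rewrite /gap /slope /right_of /lexpos /base /= /GRing.scale /=.
    + constructor 1; have : 0 < lam * s by rewrite mulr_gt0//; lra.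
      lra.
    + move: t0; rewrite le_eqVlt => /orP[/eqP <-|t0].
        by constructor 2; split; lra.
      constructor 1; have := mulr_gt0 s0 t0; lra.
    + by constructor 3; split; lra.
    + constructor 1; have : 0 < s * (lam * a - t) by rewrite mulr_gt0// subr_gt0.
      lra.
  - move=> t _; apply: blocked_big => /(_ Short).
    by rewrite big_gap /gap /= /GRing.scale /=; lra.
  - apply: soon_all => x x0 i /copy_big/(_ LegR).
    rewrite big_gap /gap /base /= /GRing.scale /=.
    have := mulr_gt0 s0 x0; lra.
have la : a < lam * a by rewrite -subr_gt0 -{2}[a]mul1r -mulrBl mulr_gt0// subr_gt0.
have t0 : 0 <= (0 : R) < lam * a by rewrite lexx/=; lra.
have ns : no_straddle (p + 0 *: r) r.
  apply: no_straddle_out; apply: soon_all => x x0 i /copy_big/(_ LegL).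
  rewrite big_gap /gap /= /GRing.scale /=.
  have := mulr_gt0 s0 x0; lra.
have [i [e [ef _ ns1]]] := side_step fs t0 ns.
have [eS|eS] : e = Short \/ e <> Short by case: (e); [right|right|left|right].
  subst e; have t1 : 0 <= (0 + a) < lam * a by rewrite add0r la (ltW a0).
  have [_ fs1 _ _] := fs.
  have [|||||j] := @wedge (p + (0 + a) *: r) r.
  - by rewrite /unit_vec /=; lra.
  - exact: fs1.
  - exact: side_blocked fs t1.
  - exists 1 => // x /andP[x0 x1].
    have [|H1 H2] := @edge_pt i LegR x; first by rewrite /= x1 ltW.
    have [dE oE] := edge_from_frame ef.
    have E : corner (o i) (d i) LegR + x *: dir (d i) LegR = p + (0 + a) *: r + x *: rot r (c, - s).
      by rewrite oE dE /r /p; apply: plane_eq; rewrite /corner /dir /rot /= /GRing.scale /=; ring.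
    by apply: (@blocked_copy i); rewrite -E.
  - exact: ns1.
  by case=> /(side_first fs t1)[x [y [z E]]]; [exists x.+1, y.+1, z|exists x, y.+1, z.+1];
    rewrite [LHS]E -!natr1 /= ?addnS; split => //; ring.
have [x [y [z E]]] := side_first fs t0 ef.
case: e eS {ef ns1} E => //= _ E; [exists x, y, z.+1|exists x.+1, y, z|exists x.+1, y, z];
    rewrite [LHS]E -!natr1 /= ?addnS; split => //; ring.
Qed.

(** A base carrying legs only would carry infinitely many of them: starting at
   an acute corner, each leg leaves room for just another acute angle. *)
Lemma base_lengths : exists x y z : nat, lam * b = x%:R + y%:R * a + z.+1%:R * b.
Proof.
have a0 := a_gt0; have l1 := lam_gt1; have s0 := s_gt0; have c0 := c_gt0; have b0 := b_gt0.
have sc : 0 < s * c by rewrite mulr_gt0.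
have sa : 0 < s * a by rewrite mulr_gt0.
pose p : plane R := (lam * b, 0); pose r : plane R := (-1, 0).
have r1 : unit_vec r by rewrite /unit_vec /=; lra.
have lb : 0 < lam * b by rewrite mulr_gt0//; lra.
have fs : free_side p r (lam * b).
  split => //.
  - move=> t /andP[t0 tl]; apply: big_germ.
    case; rewrite /gap /slope /right_of /lexpos /= /GRing.scale /=.
    + by constructor 3; split; lra.
    + constructor 1; have : 0 < s * (lam * b - t) by rewrite mulr_gt0// subr_gt0.
      lra.
    + constructor 1; have : 0 < lam * s by rewrite mulr_gt0//; lra.
      lra.
    + move: t0; rewrite le_eqVlt => /orP[/eqP <-|t0].
        by constructor 2; split; lra.
      constructor 1; have := mulr_gt0 s0 t0; lra.
  - move=> t _; apply: blocked_big => /(_ Long).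
    by rewrite big_gap /gap /= /GRing.scale /=; lra.
  - apply: soon_all => x x0 i /copy_big/(_ LegL).
    rewrite big_gap /gap /= /GRing.scale /=.
    have := mulr_gt0 s0 x0; lra.
suff [k [i [k0 ef]]] : exists (k : nat) i, 0 <= (k%:R : R) < lam * b /\ edge_from i Long (p + k%:R *: r) r.
  have [x [y [z E]]] := side_first fs k0 ef.
  by exists (k + x)%N, y, z; rewrite [LHS]E natrD -natr1 /=; ring.
apply: contrapT => noL.
have H (j : nat) : [/\ j%:R < lam * b, no_straddle (p + j%:R *: r) r &
    soon (fun x => blocked (p + j%:R *: r + x *: rot r (c, - s)))].
  elim: j => [|j [jl ns Hb]].
    split => //.
    - apply: no_straddle_out; apply: soon_all => x x0 i /copy_big/(_ LegR).
      rewrite big_gap /gap /= /GRing.scale /=.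
      have := mulr_gt0 s0 x0; lra.
    - apply: soon_all => x x0; apply: blocked_big => /(_ LegR).
      by rewrite big_gap /gap /rot /= /GRing.scale /=; lra.
  have j0 : 0 <= (j%:R : R) < lam * b by rewrite jl andbT ler0n.
  have [_ fs1 _ _] := fs.
  have [i] := wedge r1 (fs1 _ j0) (side_blocked fs j0) Hb ns.
  case=> ef; last by exfalso; apply: noL; exists j, i.
  have stop := side_stop fs j0 ef; rewrite /= natr1 in stop.
  have [dE oE] := edge_from_frame ef.
  split.
  - rewrite lt_neqAle stop andbT; apply/eqP => jE.
    have [|/copy_big/(_ LegL) H _] := @edge_pt i LegR 0; first by rewrite /= lexx ler01.
    move: H; rewrite big_gap oE dE /gap /corner /dir /rot /= /GRing.scale /=.
    have := mulr_gt0 s0 (mulr_gt0 a0 c0); move: jE; rewrite -natr1 => jE.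
    by have := congr1 (fun z => s * z) jE; have := congr1 (fun z => s * z) cs1; lra.
  - by rewrite -natr1 -shiftD; exact: (no_straddle_after ef).
  exists a => // x /andP[x0 xa].
  have [|H1 H2] := @edge_pt i Short x; first by rewrite /= xa ltW.
  have E : corner (o i) (d i) Short + x *: dir (d i) Short = p + j.+1%:R *: r + x *: rot r (c, - s).
    rewrite oE dE /r /p; apply: plane_eq; rewrite /corner /dir /rot -natr1 /= /GRing.scale /=.
      by have := congr1 (fun z => z) cs1; lra.
    by ring.
  by apply: (@blocked_copy i); rewrite -E.
have := archi_boundP (ltW lb).
by have [+ _ _] := H (Num.bound (lam * b)); lra.
Qed.

(** * Columns *)

Section Columns.
Hypothesis lam_no_long : forall x y z : nat, lam <> x%:R + y%:R * a + z.+1%:R * b.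
Hypothesis leg_no_long : forall x y z : nat, 1 <> x%:R + y%:R * a + z.+1%:R * b.

(** At each vertex of the line an acute angle is free, between the line and either
   the base or the top of the last copy. It is filled by an acute corner, whose
   side on the line is a leg, because a long base would enter the length lam. *)
Lemma up_tile X (j : nat) : 0 <= X <= lam * a ->
  (forall t, 0 < t < lam -> blocked (slant X t)) -> j%:R < lam ->
  exists i, [/\ o i = slant X j%:R, d i = (1, 0), j.+1%:R <= lam &
    no_straddle (slant X j.+1%:R) zeta].
Proof.
have s0 := s_gt0; have a0 := a_gt0; have c0 := c_gt0; have cs := cs1; have l1 := lam_gt1.
move=> X0 Hb; have fs := slant_side X0 Hb.
have [_ fs1 _ _] := fs.
have main (k : nat) : k%:R < lam -> no_straddle (slant X k%:R) zeta ->
    soon (fun x => blocked (slant X k%:R + x *: ((1, 0) : plane R))) ->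
  exists i, [/\ o i = slant X k%:R, d i = (1, 0), k.+1%:R <= lam &
    no_straddle (slant X k.+1%:R) zeta].
  move=> kl ns Hb2; have k0 : 0 <= (k%:R : R) < lam by rewrite kl andbT ler0n.
  have rz : rot zeta (c, - s) = (1, 0) by apply: plane_eq; rewrite /rot /=; have := cs1; lra.
  have [||||i] := @wedge (slant X k%:R) zeta zeta_unit.
  - by rewrite slantE; exact: fs1.
  - by rewrite slantE; exact: side_blocked fs k0.
  - by rewrite rz.
  - exact: ns.
  rewrite slantE; case=> [ef|ef]; last first.
    have [x [y [z lE]]] := side_first fs k0 ef.
    exfalso; apply: (lam_no_long (x := k + x) (y := y) (z := z)).
    by rewrite [LHS]lE natrD -natr1 /=; ring.
  have [dE oE] := edge_from_frame ef.
  exists i; rewrite oE dE /=; split.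
  - by apply: plane_eq; rewrite /rot /=; ring.
  - exact: rz.
  - by have := side_stop fs k0 ef; rewrite /= natr1.
  - by rewrite slantE -natr1 -shiftD; exact: (no_straddle_after ef).
elim: j => [|j IH] jl; apply: main => //.
- apply: no_straddle_out; apply: soon_all => x x0 i /copy_big/(_ Long).
  rewrite big_gap /gap /slant /= /GRing.scale /=.
  have : 0 < x * s by rewrite mulr_gt0.
  lra.
- apply: soon_all => x x0; apply: blocked_big => /(_ Long).
  by rewrite big_gap /gap /slant /= /GRing.scale /=; lra.
- by have [|i []] := IH; first by rewrite (lt_trans _ jl)// ltr_nat.
have [|i [oE dE _ _]] := IH; first by rewrite (lt_trans _ jl)// ltr_nat.
exists a => // y /andP[y0 ya].
have [|H1 H2] := @edge_pt i Short y; first by rewrite (ltW y0).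
have E : corner (o i) (d i) Short + y *: dir (d i) Short = slant X j.+1%:R + y *: ((1, 0) : plane R).
  rewrite oE dE; apply: plane_eq; rewrite /corner /dir /slant /rot -natr1 /= /GRing.scale /=; ring.
by apply: (@blocked_copy i); rewrite -E.
Qed.

Lemma lam_nat : exists J : nat, lam = J.+2%:R.
Proof.
have a0 := a_gt0; have l1 := lam_gt1; have s0 := s_gt0.
have X0 : 0 <= (0 : R) <= lam * a by rewrite lexx/= mulr_ge0//; lra.
have Hb t : 0 < t < lam -> blocked (slant 0 t).
  move=> _; apply: blocked_big => /(_ LegL).
  by rewrite big_gap /gap /slant /=; lra.
have [J lE] : exists J : nat, lam = J%:R.
  apply: contrapT => /forallNP nJ.
  have H (j : nat) : j%:R <= lam.
    elim: j => [|j IH]; first lra.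
    have jl : j%:R < lam by rewrite lt_neqAle IH andbT eq_sym; apply/eqP.
    by have [i []] := up_tile X0 Hb jl.
  have l0 : 0 <= lam by lra.
  by have := archi_boundP l0; rewrite ltNge H.
move: lE l1; case: J => [|[|J]] ->; rewrite ?ltr10 ?ltxx// => _.
by exists J.
Qed.

Lemma upside_down i p : edge_from i LegR p (- c, s) ->
  d i = (-1, 0) /\ o i = p + (c + a, s).
Proof.
move=> /edge_from_frame[dE ->]; have {}dE : d i = (-1, 0).
  by rewrite dE; apply: plane_eq; rewrite /rot /=; have := cs1; lra.
by rewrite dE; split => //; apply: plane_eq; rewrite /rot /=; ring.
Qed.

(** A left leg or a short base that runs like a right leg of the large trapezoid,
   but upwards, ends in an obtuse angle; this contains the direction (1, 0), which
   makes only an acute angle with the line of the side. *)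
Lemma obtuse_end i e p : e = LegL \/ e = Short ->
  edge_from i e p (- c, s) ->
  soon (fun x => copy_in i (p + len e *: ((- c, s) : plane R) + x *: ((1, 0) : plane R))).
Proof.
have sc : 0 < s * c by rewrite mulr_gt0.
have sa : 0 < s * a by rewrite mulr_gt0.
have cs := cs1; have s0 := s_gt0.
have ccs : c * (c * c + s * s) = c by rewrite cs mulr1.
have scs : s * (c * c + s * s) = s by rewrite cs mulr1.
move=> eLS /edge_from_frame[dE oE]; case: eLS => eE; rewrite eE in dE oE *.
  apply: (@soon_copy_in i _ _ (c, s) (s * s - c * c, - (2 * s * c))).
  - by rewrite oE dE; apply: plane_eq; rewrite /rot /= /GRing.scale /=; lra.
  - rewrite dE; apply: plane_eq; rewrite /rot /=; last by ring.
    have : (c * c + s * s) * (c * c + s * s) = 1 by rewrite cs mulr1.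
    lra.
  - by case; rewrite /gap /slope /base /=; [left|right|right|left]; try split; lra.
apply: (@soon_copy_in i _ _ (c + a, s) (- c, - s)).
- by rewrite oE dE; apply: plane_eq; rewrite /rot /= /GRing.scale /=; lra.
- by rewrite dE; apply: plane_eq; rewrite /rot /=; lra.
- by case; rewrite /gap /slope /base /=; [left|left|right|right]; try split; lra.
Qed.

(** The right leg of the upright copy of index j is covered on its right by sides of
   total length 1, hence without long base. At its upper end V an acute angle is
   free, below the base of the next upright copy or below the top side. So the last
   of these sides does not end in an obtuse angle at V, and it is the right leg of a
   copy turned upside down. The last hypothesis says that the right leg of the
   upright copy is not on the boundary of the large trapezoid. *)
Lemma down_tile X (j : nat) : 0 <= X <= lam * a ->
  (forall t, 0 < t < lam -> blocked (slant X t)) -> j.+1%:R <= lam ->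
  X + b + 2 * j%:R * c < lam * b ->
  exists i, o i = slant (X + a + b) j.+1%:R /\ d i = (-1, 0).
Proof.
have s0 := s_gt0; have a0 := a_gt0; have c0 := c_gt0; have cs := cs1; have l1 := lam_gt1.
have sa : 0 < s * a by rewrite mulr_gt0.
have sc : 0 < s * c by rewrite mulr_gt0.
move=> X0 Hb; have /andP[X0' XA] := X0.
pose u : plane R := (- c, s).
have u1 : unit_vec u by rewrite /unit_vec /=; have := cs1; lra.
have upnear (k : nat) : k%:R < lam -> exists i,
    (forall x, 0 <= x <= 2 * c -> blocked (slant X k%:R + (a + x, 0))) /\
    soon (fun x => copy_in i (slant X k%:R + (a, 0) + x *: u)).
  move=> kl; have [i [oE dE _ _]] := up_tile X0 Hb kl; exists i; split.
    move=> x /andP[x0 x1].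
    have [|H1 H2] := @edge_pt i Long (2 * c - x).
      by rewrite /= /base; apply/andP; split; lra.
    have E : corner (o i) (d i) Long + (2 * c - x) *: dir (d i) Long = slant X k%:R + (a + x, 0).
      by rewrite oE dE; apply: plane_eq; rewrite /corner /dir /slant /rot /= /GRing.scale /= /base; ring.
    by apply: (@blocked_copy i); rewrite -E.
  apply: (@soon_copy_in i _ _ (a, 0) u); rewrite ?oE ?dE.
  - by apply: plane_eq; rewrite /slant /rot /=; ring.
  - by apply: plane_eq; rewrite /rot /=; ring.
  by case; rewrite /gap /slope /u /base /=; [right|left|left|left]; try split; lra.
have down_step (k : nat) : k.+1%:R <= lam -> X + b + 2 * k%:R * c < lam * b ->
    no_straddle (slant X k%:R + (b, 0)) u ->
    exists i, o i = slant (X + a + b) k.+1%:R /\ d i = (-1, 0).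
  move=> kl Ck ns; set p := slant X k%:R + (b, 0).
  have k0 : 0 <= (k%:R : R) by exact: ler0n.
  have kl' : k%:R < lam by apply: lt_le_trans kl; rewrite ltr_nat.
  have top x : 0 < x <= 2 * c -> blocked (slant X k.+1%:R + (a + x, 0)).
    move=> /andP[x0 x1]; move: kl; rewrite le_eqVlt => /orP[/eqP lE|kl].
      by apply: blocked_big => /(_ Short); rewrite big_gap /gap /slant /= lE; lra.
    by have [i [+ _]] := upnear _ kl; apply; rewrite (ltW x0).
  have pend : p + 1 *: u = slant X k.+1%:R + (a, 0).
    by apply: plane_eq; rewrite /p /slant /base /u /= /GRing.scale /= -natr1; ring.
  have topsoon : soon (fun x => blocked (p + 1 *: u + x *: ((1, 0) : plane R))).
    exists (2 * c) => [|x /top]; first lra.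
    rewrite pend; congr blocked.
    by apply: plane_eq; rewrite /= /GRing.scale /=; ring.
  have [iT [oT dT _ _]] := up_tile X0 Hb kl'.
  have fs : free_side p u 1.
    split => //.
    - move=> t /andP[t0 t1]; apply: big_germ.
      case; rewrite /gap /slope /p /slant /right_of /lexpos /u /= /GRing.scale /=.
      + have [kt|kt] := ltP 0 (k%:R + t).
          have := mulr_gt0 kt s0.
          by constructor 1; lra.
        have [kE tE] : (k%:R : R) = 0 /\ t = 0 by split; lra.
        by constructor 2; rewrite kE tE; split; lra.
      + constructor 1; have : 0 < (1 - t) * (s * c) by rewrite mulr_gt0// subr_gt0.
        have : 0 <= s * X by rewrite mulr_ge0// ltW.
        rewrite /base; lra.
      + constructor 1; have : 0 < (1 - t) * s by rewrite mulr_gt0// subr_gt0.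
        have : 0 <= s * (lam - k.+1%:R) by rewrite mulr_ge0 ?subr_ge0// ltW.
        rewrite -natr1; lra.
      + constructor 1.
        have : 0 < s * (lam * b - (X + b + 2 * k%:R * c)) by rewrite mulr_gt0// subr_gt0.
        lra.
    - move=> t /andP[t0 t1]; have [|H1 H2] := @edge_pt iT LegR (1 - t).
        by rewrite /=; apply/andP; split; lra.
      have E : corner (o iT) (d iT) LegR + (1 - t) *: dir (d iT) LegR = p + t *: u.
        by rewrite oT dT /p; apply: plane_eq; rewrite /corner /dir /slant /rot /u /base /= /GRing.scale /=; ring.
      by apply: (@blocked_copy iT); rewrite -E.
    - have E x : p + (1 + x) *: u = slant X k.+1%:R + (a, 0) + x *: u by rewrite -pend shiftD.
      move: kl; rewrite le_eqVlt => /orP[/eqP lE|kl].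
        apply: soon_all => x x0 i; rewrite E => /copy_big/(_ Short).
        rewrite big_gap /gap /slant /u /= /GRing.scale /= lE.
        have : 0 < x * s by rewrite mulr_gt0.
        lra.
      have [i [_ Hi]] := upnear _ kl.
      apply: soon_imp Hi => x x0 Hi j'; rewrite E => /copy_in_uniq/(_ Hi) -> //.
  have [||i [e [t [x [y [z [ef t1 tE]]]]]]] := @side_walk p u 1 0 fs.
  - by rewrite lexx ltr01.
  - by rewrite scale0r addr0.
  have p1 : p + t *: u + len e *: u = p + 1 *: u by rewrite shiftD t1.
  exists i; case: e ef t1 p1 => ef t1 p1.
  - by exfalso; apply: (@leg_no_long x y z); rewrite -natr1; move: t1 => /=; lra.
  - by exfalso; apply: (soon_contra topsoon (i := i)); rewrite -p1; apply: obtuse_end ef; left.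
  - by exfalso; apply: (soon_contra topsoon (i := i)); rewrite -p1; apply: obtuse_end ef; right.
  - have [-> ->] := upside_down ef; split => //.
    have -> : t = 0 by move: t1 => /=; lra.
    by apply: plane_eq; rewrite /p /slant /base -natr1 /= /GRing.scale /=; ring.
elim: j => [|j IH] jl Cj.
  (* below the first right leg there is only the outside *)
  have ns : no_straddle (slant X 0%:R + (b, 0)) u.
    apply: no_straddle_out; apply: soon_all => x x0 i /copy_big/(_ Long).
    rewrite big_gap /gap /slant /= /GRing.scale /=.
    have : 0 < x * s by rewrite mulr_gt0.
    lra.
  exact: down_step.
(* below each other one there is the upside-down copy of the previous row *)
have ns : no_straddle (slant X j.+1%:R + (b, 0)) u.
  have [| |i [oE dE]] := IH.
  - by apply: le_trans jl; rewrite ler_nat.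
  - by move: Cj; rewrite -natr1; lra.
  apply: no_straddle_out.
  apply: soon_imp (_ : soon (fun x => copy_in i (slant X j.+1%:R + (b, 0) + x *: ((c, - s) : plane R)))).
    move=> x x0 Hi j'.
    have -> : slant X j.+1%:R + (b, 0) - x *: u = slant X j.+1%:R + (b, 0) + x *: ((c, - s) : plane R).
      by apply: plane_eq; rewrite /slant /= /GRing.scale /=; ring.
    by move=> /copy_in_uniq/(_ Hi) ->.
  apply: (@soon_copy_in i _ _ (a, 0) u); rewrite ?oE ?dE.
  - by apply: plane_eq; rewrite /slant /rot /=; ring.
  - by apply: plane_eq; rewrite /rot /=; ring.
  by case; rewrite /gap /slope /u /base /=; [right|left|left|left]; try split; lra.
exact: down_step.
Qed.

(** The next line is formed by the left legs of the copies turned upside down. *)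
Lemma next_column X : 0 <= X <= lam * a ->
  (forall t, 0 < t < lam -> blocked (slant X t)) ->
  0 <= X + a + b <= lam * a /\
  (forall t, 0 < t < lam -> blocked (slant (X + a + b) t)).
Proof.
have s0 := s_gt0; have a0 := a_gt0; have c0 := c_gt0; have b0 := b_gt0.
move=> X0 Hb; have [J lE] := lam_nat; have /andP[X0' _] := X0.
have corner_le (i : 'I_n) (e : side) (f : side) : 0 <= gap c s a lam f (corner (o i) (d i) e).
  have [|H _] := @edge_pt i e 0; first by rewrite lexx ltW// lenp.
  by move: H; rewrite scale0r addr0 => /copy_big/(_ f); rewrite big_gap.
have A1 : X + a <= lam * a.
  have [|i [oE dE _ _]] := @up_tile X J.+1 X0 Hb; first by rewrite lE ltr_nat.
  have := corner_le i LegR LegR; rewrite oE dE /corner /rot /slant /gap /= => H.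
  have : 0 <= s * (lam * a - (X + a)) by move: H; rewrite lE /base -natr1; lra.
  by rewrite pmulr_rge0// subr_ge0.
have down_le (j : nat) : j.+1%:R <= lam -> X + b + 2 * j%:R * c < lam * b ->
    X + a + b + 2 * j.+1%:R * c <= lam * b.
  move=> jl Cj; have [i [oE dE]] := down_tile X0 Hb jl Cj.
  have := corner_le i LegL LegR; rewrite oE dE /corner /rot /slant /gap /= => H.
  have : 0 <= s * (lam * b - (X + a + b + 2 * j.+1%:R * c)) by lra.
  by rewrite pmulr_rge0// subr_ge0.
(* the upside-down copy in the last row but one leaves room for one in the last row *)
have A2 : X + 2 * a <= lam * a.
  have := @down_le J; rewrite lE ler_nat => /(_ (leqnSn _)) H.
  have {}H : X + a + b + 2 * J.+1%:R * c <= J.+2%:R * b.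
    by apply: H; move: A1; rewrite lE /base -!natr1; have := c_gt0; lra.
  have := A1; have := H; rewrite lE /base -!natr1; lra.
have Cj (j : nat) : j.+1%:R <= lam -> X + b + 2 * j%:R * c < lam * b.
  rewrite lE ler_nat ltnS => jJ.
  have : (j%:R : R) * c <= J.+1%:R * c by rewrite ler_pM2r// ler_nat.
  by move: A2; rewrite lE /base -!natr1; lra.
split.
  apply/andP; split; first lra.
  have := down_le J.+1; rewrite lE lexx => /(_ isT).
  have := Cj J.+1; rewrite lE lexx => /(_ isT) H /(_ H).
  by rewrite /base -!natr1; lra.
move=> t /andP[t0 tl]; have := truncn_itv (ltW t0); set j := Num.truncn t => /andP[jt tj].
have jl : j.+1%:R <= lam.
  by move: tl; rewrite lE ler_nat -(ltr_nat R) => tl; apply: le_lt_trans jt tl.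
have [i [oE dE]] := down_tile X0 Hb jl (Cj _ jl).
have [|H1 H2] := @edge_pt i LegL (j.+1%:R - t).
  by rewrite /=; apply/andP; split; rewrite -?natr1 in tj *; lra.
have E : corner (o i) (d i) LegL + (j.+1%:R - t) *: dir (d i) LegL = slant (X + a + b) t.
  by rewrite oE dE; apply: plane_eq; rewrite /corner /dir /slant /rot /= /GRing.scale /=; ring.
by apply: (@blocked_copy i); rewrite -E.
Qed.

(** Every column would be followed by another one, of the same positive width. *)
Lemma no_columns : False.
Proof.
have a0 := a_gt0; have b0 := b_gt0; have l1 := lam_gt1.
have H (m : nat) : 0 <= m%:R * (a + b) <= lam * a /\
  (forall t, 0 < t < lam -> blocked (slant (m%:R * (a + b)) t)).
  elim: m => [|m [IH1 IH2]].
    rewrite mul0r lexx/= mulr_ge0 ?(ltW a0)//; last lra.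
    split => // t _; apply: blocked_big => /(_ LegL).
    by rewrite big_gap /gap /slant /=; lra.
  have E : m.+1%:R * (a + b) = m%:R * (a + b) + a + b by rewrite -natr1; ring.
  by rewrite E; exact: next_column.
have N0 : 0 <= lam * a / (a + b) by rewrite divr_ge0 ?mulr_ge0//; lra.
have := archi_boundP N0; rewrite ltr_pdivrMr; last lra.
by have [/andP[_ +] _] := H (Num.bound (lam * a / (a + b))); lra.
Qed.

End Columns.

Theorem cos_rational : lam ^+ 2 = n%:R -> is_rat c.
Proof.
move=> lam2; apply: contrapT => cI; have b0 := b_gt0.
have l0 : 0 < lam by apply: lt_trans lam_gt1.
have [x1 [y1 [z1 [E1 xz1]]]] := left_leg_lengths.
have [x2 [y2 [z2 [E2 xz2]]]] := top_lengths.
have [x3 [y3 [z3 E3]]] := base_lengths.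
have [lQ|lI] := pselect (is_rat lam); last first.
  exact: (no_irrational_scale lam2 lI l0 a_gt0 b0 xz1 E1 E2 E3).
have noL := rational_no_long c_gt0 a_gt0 lQ cI xz2 E2.
apply: no_columns; first exact: noL.
by apply: noL; exact: (is_rat_nat R 1).
Qed.

End Tiling.

(** * Similarities and copies of the trapezoid *)

Section Similarities.
Variable R : realType.
Implicit Types (p q : plane R) (f g : plane R -> plane R).

Lemma similarity_sqdist k f : similarity k f ->
  forall p q, sqdist (f p) (f q) = k ^+ 2 * sqdist p q.
Proof.
move=> sf p q; have := congr1 (fun x => x ^+ 2) (sf p q).
by rewrite exprMn /edist !sqr_sqrtr ?addr_ge0 ?sqr_ge0.
Qed.

Lemma similarity_comp k f l g :
  similarity k f -> similarity l g -> similarity (l * k) (g \o f).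
Proof. by move=> sf sg p q; rewrite /= sg sf mulrA. Qed.

(** Distances determine scalar products, so f maps the unit vectors to two
   orthogonal vectors u and w of length k; the sign of their determinant D
   distinguishes the two cases. *)
Lemma similarity_affine k f : 0 < k -> similarity k f ->
  exists o d, unit_vec d /\ ((forall p, f p = o + k *: rot d p) \/
    (forall p, f p = o + k *: rot d (p.1, - p.2))).
Proof.
move=> k0 /similarity_sqdist S.
have kn : k != 0 by rewrite gt_eqF.
have k2 : k ^+ 2 != 0 by rewrite expf_neq0.
have [v fv T] : exists2 v : plane R -> plane R, forall p, f p = f 0 + v p &
    forall p q, (v p).1 * (v q).1 + (v p).2 * (v q).2 = k ^+ 2 * (p.1 * q.1 + p.2 * q.2).
  exists (fun p => f p - f 0) => [p|p q]; first by rewrite addrC subrK.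
  have := S p q; have := S p 0; have := S q 0; rewrite /sqdist /= !subr0; lra.
pose u := v (1, 0); pose w := v (0, 1).
have uu := T (1, 0) (1, 0); have ww := T (0, 1) (0, 1); have uw := T (1, 0) (0, 1).
rewrite -/u -/w /= !(mulr0, mulr1, mul0r, addr0, add0r) in uu ww uw.
have vu p := T p (1, 0); have vw p := T p (0, 1).
rewrite -/u -/w /= in vu vw.
pose D := u.1 * w.2 - u.2 * w.1.
have D2 : D ^+ 2 = (k ^+ 2) ^+ 2.
  transitivity ((u.1 * u.1 + u.2 * u.2) * (w.1 * w.1 + w.2 * w.2) - (u.1 * w.1 + u.2 * w.2) ^+ 2).
    by rewrite /D; ring.
  by rewrite uu ww uw expr0n subr0 expr2.
have w1 : k ^+ 2 * w.1 = - (u.2 * D).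
  transitivity (- (u.2 * D) + u.1 * (u.1 * w.1 + u.2 * w.2)); last by rewrite uw mulr0 addr0.
  by rewrite -uu /D; ring.
have w2 : k ^+ 2 * w.2 = u.1 * D.
  transitivity (u.1 * D + u.2 * (u.1 * w.1 + u.2 * w.2)); last by rewrite uw mulr0 addr0.
  by rewrite -uu /D; ring.
have vE p : D * (v p).1 = k ^+ 2 * (p.1 * w.2 - p.2 * u.2) /\
            D * (v p).2 = k ^+ 2 * (p.2 * u.1 - p.1 * w.1).
  have := vu p; have := vw p; rewrite !(mulr0, mulr1, addr0, add0r) /D => e2 e1.
  split.
    by have := congr1 (fun x => x * w.2) e1; have := congr1 (fun x => x * u.2) e2; rewrite /=; lra.
  by have := congr1 (fun x => x * w.1) e1; have := congr1 (fun x => x * u.1) e2; rewrite /=; lra.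
pose d : plane R := (u.1 / k, u.2 / k).
have d1 : unit_vec d.
  rewrite /unit_vec /d /=.
  have -> : u.1 / k * (u.1 / k) + u.2 / k * (u.2 / k) = (u.1 * u.1 + u.2 * u.2) / k ^+ 2 by field.
  by rewrite uu divff.
exists (f 0), d; split => //.
have fE p q : v p = q -> f p = f 0 + q by move=> <-.
move/eqP: D2; rewrite eqf_sqr => /orP[] /eqP DE; rewrite DE in w1 w2 vE; [left|right] => p; apply: fE.
  have w1' : w.1 = - u.2 by apply: (mulfI k2); rewrite w1; ring.
  have w2' : w.2 = u.1 by apply: (mulfI k2); rewrite w2; ring.
  have [/(mulfI k2) v1 /(mulfI k2) v2] := vE p.
  by apply: plane_eq; rewrite ?v1 ?v2 ?w1' ?w2' /d /rot /= /GRing.scale /=; field.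
have w1' : w.1 = u.2 by apply: (mulfI k2); rewrite w1; ring.
have w2' : w.2 = - u.1 by apply: (mulfI k2); rewrite w2; ring.
have [v1 v2] := vE p.
have {}v1 : (v p).1 = - (p.1 * w.2 - p.2 * u.2) by apply: (mulfI k2); lra.
have {}v2 : (v p).2 = - (p.2 * u.1 - p.1 * w.1) by apply: (mulfI k2); lra.
by apply: plane_eq; rewrite ?v1 ?v2 ?w1' ?w2' /d /rot /= /GRing.scale /=; field.
Qed.

End Similarities.

Section TrapezoidCopies.
Variables (R : realType) (c s a : R).
Hypotheses (c_gt0 : 0 < c) (s_gt0 : 0 < s) (a_gt0 : 0 < a).
Hypothesis cs1 : c * c + s * s = 1.
Implicit Types (p q o d : plane R) (f : plane R -> plane R).
Local Notation b := (base c a).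

Lemma gap_at_scale t l o d e p :
  gap_at c s a (t * l) (t *: o) d e (t *: p) = t * gap_at c s a l o d e p.
Proof. by case: e; rewrite /gap_at /gap /unrot /= /GRing.scale /=; ring. Qed.

Lemma tile_scale t l o d p : 0 < t ->
  tile c s a (t * l) (t *: o) d (t *: p) <-> tile c s a l o d p.
Proof.
by move=> t0; split=> H e; have := H e; rewrite gap_at_scale pmulr_rge0.
Qed.

Lemma tile_in_scale t l o d p : 0 < t ->
  tile_in c s a (t * l) (t *: o) d (t *: p) <-> tile_in c s a l o d p.
Proof.
by move=> t0; split=> H e; have := H e; rewrite gap_at_scale pmulr_rgt0.
Qed.

(** The trapezoid is its own mirror image, so a copy of it is always the image
   under an orientation-preserving similarity. *)
Lemma similar_copy k f : 0 < k -> similarity k f -> exists o d, unit_vec d /\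
  f @` [set p | tile c s a 1 0 (1, 0) p] = [set p | tile c s a k o d p].
Proof.
move=> k0 sf; have [ctr [d [d1 fE]]] := similarity_affine k0 sf.
have local_gap o' d' p e : unit_vec d' ->
    gap_at c s a k o' d' e (o' + k *: rot d' p) = k * gap_at c s a 1 0 (1, 0) e p.
  move=> u1; rewrite /gap_at addrAC subrr add0r.
  have -> : k *: rot d' p = rot d' (k *: p) by apply: plane_eq; rewrite /rot /= /GRing.scale /=; ring.
  by rewrite unrotK//; case: e; rewrite /gap /unrot /= /GRing.scale /=; ring.
have img o' d' : unit_vec d' ->
    [set o' + k *: rot d' p | p in [set p | tile c s a 1 0 (1, 0) p]] = [set p | tile c s a k o' d' p].
  move=> u1; apply/seteqP; split => [q /= [p Hp <-] e|q Hq].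
    by rewrite (local_gap _ _ _ _ u1) mulr_ge0 ?(ltW k0).
  have qE : q = o' + k *: rot d' (k^-1 *: unrot d' (q - o')).
    have -> : k *: rot d' (k^-1 *: unrot d' (q - o')) = rot d' (unrot d' (q - o')).
      by apply: plane_eq; rewrite /rot /= /GRing.scale /=; field; rewrite gt_eqF.
    by rewrite rotK// addrC subrK.
  exists (k^-1 *: unrot d' (q - o')) => // e.
  by have := Hq e; rewrite {1}qE (local_gap _ _ _ _ u1) pmulr_rge0.
case: fE => fE.
  exists ctr, d; split => //; rewrite -img//.
  have -> : f = (fun p => ctr + k *: rot d p) by apply/funext.
  by [].
have u1 : unit_vec (- d) by move: d1; rewrite /unit_vec /= !mulrNN.
exists (ctr + k *: rot d (b, 0)), (- d); split => //; rewrite -img//.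
have flip p : tile c s a 1 0 (1, 0) p -> tile c s a 1 0 (1, 0) (b - p.1, p.2).
  move=> H; have := H Long; have := H LegL; have := H Short; have := H LegR.
  rewrite /gap_at /gap /unrot /= => H1 H2 H3 H4.
  by case; rewrite /gap_at /gap /unrot /=; lra.
apply/seteqP; split => q /= [p Hp <-]; exists (b - p.1, p.2) => //; try exact: flip;
  by rewrite fE; apply: plane_eq; rewrite /rot /= /GRing.scale /=; ring.
Qed.

Lemma tile_in_interior k o d p : tile_in c s a k o d p ->
  ([set q | tile c s a k o d q])° p.
Proof.
move=> H.
have near e : exists2 x : R, 0 < x & forall q, `|p.1 - q.1| < x -> `|p.2 - q.2| < x ->
    0 <= gap_at c s a k o d e q.
  pose al := slope c s e (unrot d (1, 0)); pose be := slope c s e (unrot d (0, 1)).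
  have E q : gap_at c s a k o d e q =
      gap_at c s a k o d e p - (p.1 - q.1) * al - (p.2 - q.2) * be.
    by rewrite /al /be; case: (e); rewrite /gap_at /gap /slope /unrot /=; ring.
  have g0 := H e; set g := gap_at _ _ _ _ _ _ _ p in g0 E.
  have N0 : 0 < `|al| + `|be| + 1 by rewrite ltr_wpDl// addr_ge0.
  exists (g / (`|al| + `|be| + 1)); first exact: divr_gt0.
  set x := g / _ => q q1 q2; rewrite E.
  have x0 : 0 < x by exact: divr_gt0.
  have gE : g = x * `|al| + x * `|be| + x.
    have : g = x * (`|al| + `|be| + 1) by rewrite /x divfK// gt_eqF.
    by move=> ->; ring.
  have h1 : (p.1 - q.1) * al <= x * `|al|.
    by apply: le_trans (ler_norm _) _; rewrite normrM ler_wpM2r// ltW.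
  have h2 : (p.2 - q.2) * be <= x * `|be|.
    by apply: le_trans (ler_norm _) _; rewrite normrM ler_wpM2r// ltW.
  lra.
have [x1 x10 H1] := near Long; have [x2 x20 H2] := near LegL.
have [x3 x30 H3] := near Short; have [x4 x40 H4] := near LegR.
rewrite /interior; apply/nbhs_ballP.
exists (Num.min (Num.min x1 x2) (Num.min x3 x4)); first by rewrite /= !lt_min x10 x20 x30.
move=> q [] /=; rewrite /ball /= !lt_min => /andP[/andP[? ?] /andP[? ?]] /andP[/andP[? ?] /andP[? ?]].
by case; [apply: H1|apply: H2|apply: H3|apply: H4].
Qed.

(** Each point is on the horizontal segment between the two legs at its height. *)
Lemma trapezoid_hull :
  convex_hull [set (0, 0); (a + 2 * c, 0); (c + a, s); (c, s)] =
  [set p : plane R | tile c s a 1 0 (1, 0) p].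
Proof.
have sc : 0 < s * c by rewrite mulr_gt0.
have sa : 0 < s * a by rewrite mulr_gt0.
have s0 := s_gt0; have c0 := c_gt0; have a0 := a_gt0.
apply/seteqP; split.
  apply: smallest_sub.
    move=> x y t /[!inE] /= Hx Hy e.
    have := Hx e; have := Hy e.
    have -> : gap_at c s a 1 0 (1, 0) e (conv t x y) =
      t%:num * gap_at c s a 1 0 (1, 0) e x + (1 - t%:num) * gap_at c s a 1 0 (1, 0) e y.
      have -> : conv t x y = t%:num *: (x : plane R) + (1 - t%:num) *: (y : plane R) by [].
      move: (t%:num) => t'; case: x {Hx} => x1 x2; case: y {Hy} => y1 y2.
      by case: (e); rewrite /gap_at /gap /unrot /= /GRing.scale /=; ring.
    move=> g1 g2; have t0 : 0 <= t%:num by exact: ge0.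
    have t1 : t%:num <= 1 by exact: le1.
    by apply: addr_ge0; apply: mulr_ge0; rewrite // subr_ge0.
  move=> p /= [[[->|->]|->]|->] e; rewrite /gap_at subr0; case: e; rewrite /gap /unrot /base /=; lra.
move=> p Hp A [Aconv AS].
have := Hp Long; have := Hp LegL; have := Hp Short; have := Hp LegR.
rewrite /gap_at subr0 /gap /unrot /base /= => g4 g3 g2 g1.
have A1 : A (0, 0) by apply: AS; left; left; left.
have A2 : A (a + 2 * c, 0) by apply: AS; left; left; right.
have A3 : A (c + a, s) by apply: AS; left; right.
have A4 : A (c, s) by apply: AS; right.
have conv_in (u v : plane R) (t : R) : A u -> A v -> 0 <= t <= 1 -> A (t *: u + (1 - t) *: v).
  move=> Au Av /andP[t0 t1]; have := Aconv u v (Itv01 t0 t1); rewrite !inE => H.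
  exact: H.
pose t := p.2 / s.
have ts : t * s = p.2 by rewrite /t divfK// gt_eqF.
have t01 : 0 <= t <= 1.
  by apply/andP; split; rewrite -(ler_pM2r s_gt0) ts; lra.
have /andP[t0 t1] := t01.
have W0 : 0 < a + 2 * c - 2 * t * c.
  by have := mulr_ge0 (ltW c_gt0) (_ : 0 <= 1 - t); rewrite subr_ge0 => /(_ t1); lra.
pose u := (p.1 - t * c) / (a + 2 * c - 2 * t * c).
have uW : u * (a + 2 * c - 2 * t * c) = p.1 - t * c by rewrite /u divfK// gt_eqF.
have cp : c * p.2 = s * (t * c) by rewrite -ts; ring.
have u01 : 0 <= u <= 1.
  apply/andP; split; rewrite -(ler_pM2r W0) uW -(ler_pM2l s_gt0); lra.
have -> : p = u *: (t *: ((c + a, s) : plane R) + (1 - t) *: ((a + 2 * c, 0) : plane R)) +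
    (1 - u) *: (t *: ((c, s) : plane R) + (1 - t) *: ((0, 0) : plane R)).
  apply: plane_eq; rewrite /= /GRing.scale /=; lra.
have Ar := conv_in _ _ _ A3 A2 t01; have Al := conv_in _ _ _ A4 A1 t01.
exact: conv_in Ar Al u01.
Qed.

End TrapezoidCopies.

(** The pieces are all congruent to the first one, so the ratio k of a single
   similarity is that of all of them, and lam = 1 / k. *)
Lemma reptile_tiling (R : realType) (c s a : R) :
  0 < c -> 0 < s -> 0 < a -> c * c + s * s = 1 ->
  reptile [set p : plane R | tile c s a 1 0 (1, 0) p] ->
  exists (n : nat) (lam : R) (o d : 'I_n -> plane R),
  [/\ (2 <= n)%N, 0 < lam, forall i, unit_vec (d i),
    forall p, tile c s a lam 0 (1, 0) p <-> exists i, tile c s a 1 (o i) (d i) p &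
    forall i j p, tile_in c s a 1 (o i) (d i) p -> tile_in c s a 1 (o j) (d j) p -> i = j].
Proof.
move=> c0 s0 a0 cs1; set A := [set p | _]; move=> [n n2 [T [[TA Tdis] Tsim Tcong]]].
have i0 : 'I_n by exists 0%N; exact: ltnW.
have [k [f [k0 sf T0]]] := Tsim i0.
have /choice[op Hop] : forall i, exists op : plane R * plane R, unit_vec op.2 /\
    T i = [set p | tile c s a k op.1 op.2 p].
  move=> i; have [g sg Ti] := Tcong i0 i.
  have sgf := similarity_comp sf sg; rewrite mul1r in sgf.
  have [ctr [d [d1 E]]] := similar_copy c s a k0 sgf.
  by exists (ctr, d); split => //; rewrite Ti T0 image_comp -E.
have ki0 : 0 < k^-1 by rewrite invr_gt0.
have kk : k^-1 * k = 1 by rewrite mulVf// gt_eqF.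
exists n, k^-1, (fun i => k^-1 *: (op i).1), (fun i => (op i).2); split => //.
- by move=> i; case: (Hop i).
- move=> p.
  have pE : p = k^-1 *: (k *: p) by rewrite scalerA kk scale1r.
  have -> : tile c s a k^-1 0 (1, 0) p <-> A (k *: p).
    by rewrite {1}pE -[X in tile _ _ _ X]mulr1 -[X in tile _ _ _ _ X](scaler0 _ k^-1) tile_scale.
  rewrite -TA; split => [[i _]|[i Hi]].
    have [_ ->] := Hop i; exists i.
    by rewrite pE -kk tile_scale.
  exists i => //; have [_ ->] := Hop i => /=.
  by rewrite pE -kk tile_scale in Hi.
move=> i j p Hi Hj; apply: contrapT => /eqP ij.
have pE : p = k^-1 *: (k *: p) by rewrite scalerA kk scale1r.
have := Tdis i j ij; rewrite -subset0 => /(_ (k *: p)); apply.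
split; [have [_ ->] := Hop i|have [_ ->] := Hop j]; apply: tile_in_interior.
  by rewrite pE -kk tile_in_scale in Hi.
by rewrite pE -kk tile_in_scale in Hj.
Qed.

(** * Angles with rational cosine *)

(** Niven: the numbers v^m * 2 cos(m theta), where 2 cos(theta) = u / v in lowest
   terms, are integers congruent to u^m modulo v; so v is a unit if one of the
   2 cos(m theta) is an integer. *)
Lemma rational_cos_rational_angle (R : realType) (theta : R) :
  0 < theta -> theta < pi / 2 -> is_rat (cos theta) -> is_rat (theta / pi) ->
  theta = pi / 3.
Proof.
move=> th0 th1 [r rE] [q qE]; have p0 : 0 < pi :> R := pi_gt0 R.
have c0 : 0 < cos theta by apply: cos_gt0_pihalf; apply/andP; split; lra.
pose x := 2 * r; pose u := numq x; pose v := denq x.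
have v0 : v != 0 by rewrite denq_eq0.
have vR : (v%:~R : R) != 0 by rewrite intr_eq0.
have xE : v%:~R * (2 * cos theta) = u%:~R :> R.
  have -> : 2 * cos theta = ratr x by rewrite rE /x rmorphM /= ratr_nat.
  by rewrite /ratr mulrC divfK.
pose w (m : nat) := 2 * cos (m%:R * theta).
have wE (m : nat) : w m.+2 = 2 * cos theta * w m.+1 - w m.
  rewrite /w.
  have -> : m.+2%:R * theta = m.+1%:R * theta + theta by rewrite -[m.+2%:R]natr1; ring.
  have -> : m%:R * theta = m.+1%:R * theta - theta by rewrite -natr1; ring.
  by rewrite cosD cosB; ring.
have cong (m : nat) : (exists z : int, v%:~R ^+ m.+1 * w m.+1 = u%:~R ^+ m.+1 + v%:~R * z%:~R) /\
    (exists z : int, v%:~R ^+ m.+2 * w m.+2 = u%:~R ^+ m.+2 + v%:~R * z%:~R).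
  elim: m => [|m [[z0 E0] [z1 E1]]].
    have w0 : w 0%N = 2 by rewrite /w mul0r cos0 mulr1.
    have w1 : w 1%N = 2 * cos theta by rewrite /w mul1r.
    split; first by exists 0; rewrite w1 expr1 xE mulr0 addr0.
    exists (- 2 * v); rewrite wE w0 w1 intrM !expr2 -xE; ring.
  split; first by exists z1.
  exists (u * z1 - v * (u ^+ m.+1 + v * z0)).
  rewrite wE.
  have -> : v%:~R ^+ m.+3 * (2 * cos theta * w m.+2 - w m.+1) =
    (v%:~R * (2 * cos theta)) * (v%:~R ^+ m.+2 * w m.+2) - v%:~R ^+ 2 * (v%:~R ^+ m.+1 * w m.+1) :> R.
    by rewrite [_ ^+ m.+3]exprS [_ ^+ m.+2]exprS; ring.
  by rewrite xE E0 E1 intrB !intrM intrD rmorphXn intrM [_ ^+ m.+3]exprS /=; ring.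
have q0 : 0 < q by rewrite -(ltr0q R) -qE divr_gt0.
pose K := `|denq q|%N; pose P := `|numq q|%N.
have KE : K%:R * theta = P%:R * pi.
  have -> : theta = ratr q * pi by rewrite -qE divfK// gt_eqF.
  rewrite mulrA; congr (_ * _); rewrite /ratr /K /P !natr_absz.
  rewrite !ger0_norm ?denq_ge0//; last by rewrite numq_ge0 ltW.
  by rewrite mulrC divfK// intr_eq0 denq_eq0.
have cosP (m : nat) : cos (m%:R * pi) = (-1) ^+ m :> R.
  elim: m => [|m IH]; first by rewrite mul0r cos0.
  by rewrite -natr1 mulrDl mul1r cosDpi IH exprS mulN1r.
have [K' KS] : exists K', K = K'.+1.
  by exists K.-1; rewrite prednK// absz_gt0 denq_eq0.
have [[z]] := cong K'; rewrite -KS /w KE cosP => E _.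
have {}E : u ^+ K = v * (v ^+ K' * 2 * (-1) ^+ P - z).
  apply: (intr_inj (R := R)).
  rewrite rmorphXn intrM intrB !intrM !rmorphXn /= rmorphN1.
  by move: E; rewrite {1}KS exprS; lra.
have v1 : v = 1.
  have /dvdzP : exists y, u ^+ K = y * v by exists (v ^+ K' * 2 * (-1) ^+ P - z); rewrite E mulrC.
  rewrite dvdzE abszX => dv.
  have := coprime_num_den x; rewrite -/u -/v => /(coprimeXl K).
  rewrite /coprime gcdnC => /eqP g1.
  have := dvdn_gcd `|v| `|v| (`|u| ^ K); rewrite dvdnn dv g1 dvdn1 => /eqP.
  by have := denq_gt0 x; rewrite -/v; case: (v) => [[|[|k]]|k].
have cosE : 2 * cos theta = u%:~R by rewrite -xE v1 mul1r.
have cos1 : cos theta < 1.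
  have s0 : 0 < sin theta by apply: sin_gt0_pihalf; rewrite th0.
  by have := cos2Dsin2 theta; nra.
have u1 : u = 1.
  have : (0 : R) < u%:~R by rewrite -cosE mulr_gt0.
  have : (u%:~R : R) < 2%:~R by rewrite -cosE; lra.
  by rewrite ltr0z ltr_int; case: (u) => [[|[|k]]|k].
have ch : cos theta = 1 / 2 by rewrite u1 in cosE; lra.
have chp : cos (pi / 3) = 1 / 2 :> R.
  have C0 : 0 < cos (pi / 3) :> R by apply: cos_gt0_pihalf; apply/andP; split; lra.
  have : cos (pi / 3 + pi / 3 + pi / 3) = -1 :> R.
    by rewrite -cospi; congr cos; field.
  rewrite !cosD sinD.
  have : sin (pi / 3) * sin (pi / 3) = 1 - cos (pi / 3) * cos (pi / 3) :> R.
    by have := cos2Dsin2 (pi / 3 : R); rewrite !expr2; lra.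
  move: (cos (pi / 3)) (sin (pi / 3)) C0 => C S C0 S2 F.
  have /eqP : (C + 1) * (2 * C - 1) ^+ 2 = 0.
    have := congr1 (fun z => C * z) S2; rewrite /= => CS; move: F; rewrite expr2; lra.
  rewrite mulf_eq0 sqrf_eq0 => /orP[] /eqP; lra.
by apply: cos_inj; rewrite ?in_itv/= ?ch ?chp//; apply/andP; split; lra.
Qed.

(** * Reptiles with a rational angle *)

Theorem corollary3p4 (R : realType) (theta a : R)
  (theta_gt0 : 0 < theta) (theta_lt : theta < pi / 2) (a_gt0 : 0 < a)
  (hrep : reptile (isosceles_trapezoid theta a))
  (hrat : exists q : rat, theta / pi = ratr q) :
  theta = pi / 3.

Proof.
have c0 : 0 < cos theta by apply: cos_gt0_pihalf; apply/andP; split; lra.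
have s0 : 0 < sin theta by apply: sin_gt0_pihalf; rewrite theta_gt0.
have cs1 : cos theta * cos theta + sin theta * sin theta = 1.
  by rewrite -!expr2; exact: cos2Dsin2.
move: hrep; rewrite /isosceles_trapezoid (trapezoid_hull c0 s0 a_gt0).
move=> /(reptile_tiling c0 s0 a_gt0 cs1)[n [lam [ctr [d [n2 l0 d1 cov disj]]]]].
have in_big i p : tile_in (cos theta) (sin theta) a 1 (ctr i) (d i) p ->
    tile_in (cos theta) (sin theta) a lam 0 (1, 0) p.
  by move=> Hi; apply: contrapT => /(blocked_big s0 cov)/(_ i).
have lam2 := scale_square c0 s0 a_gt0 l0 cs1 n2 d1 cov disj in_big.
have lam1 : 1 < lam.
  rewrite -(ltr_pXn2r (n := 2))// ?nnegrE ?(ltW l0)// expr1n lam2 ltr1n.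
  exact: n2.
apply: rational_cos_rational_angle => //.
exact: (cos_rational c0 s0 a_gt0 lam1 cs1 d1 cov disj lam2).
Qed.
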